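(* Let $n\ge2$, $\rho=\frac{n-1}{2}$ and let $\lambda\in\mathbb{C}$ with $\mathrm{Im}(\lambda)>0$. Suppose $u$ is an eigenfunction of the Laplace-Beltrami operator $\Delta_{\mathbb{H}^n}$ on $\mathbb{H}^n$ with eigenvalue $-(\lambda^2+\rho^2)$, and suppose that $$\sup_{y>0}\,y^{\mathrm{Im}(\lambda)-\rho}\,\|u(\cdot,y)\|_{L^\infty(\mathbb{R}^{n-1})}<\infty.$$ Let $f\in L^\infty(\mathbb{R}^{n-1})$ be the boundary function of $u$. Then for $x_0\in\mathbb{R}^{n-1}$ and $L\in\mathbb{C}$, $$\lim_{y\to\infty}y^{-(\rho+i\lambda)}u(x_0,y)=L$$ if and only if $$\lim_{r\to\infty}\frac{1}{m(B(x_0,r))}\int_{B(x_0,r)}f(x)\,dx=L.$$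
   Context: $\mathbb{H}^n=\{(x,y): x\in\mathbb{R}^{n-1},\ y\in(0,\infty)\}$, $n\ge2$, is the upper half space model of real hyperbolic space with metric $ds^2=y^{-2}(dx^2+dy^2)$, and $\Delta_{\mathbb{H}^n}=y^2\left(\Delta_x+\frac{\partial^2}{\partial y^2}\right)-(n-2)y\frac{\partial}{\partial y}$, where $\Delta_x$ is the Euclidean Laplacian on $\mathbb{R}^{n-1}$; $u$ is an eigenfunction with eigenvalue $-(\lambda^2+\rho^2)$ if $\Delta_{\mathbb{H}^n}u=-(\lambda^2+\rho^2)u$. Powers of a positive real with complex exponent are $y^z=e^{z\log y}$. For $\mathrm{Im}(\lambda)>0$ define the normalized generalized Poisson kernel $$P_\lambda(x,y)=d_\lambda\left[\frac{y}{y^2+\|x\|^2}\right]^{\rho-i\lambda},\qquad (x,y)\in\mathbb{H}^n,$$ where the constant $d_\lambda\in\mathbb{C}$ is chosen so that $\int_{\mathbb{R}^{n-1}}P_\lambda(x,1)\,dx=1$. For $f\in L^\infty(\mathbb{R}^{n-1})$ its Poisson transform is $P_\lambda f(x,y)=\int_{\mathbb{R}^{n-1}}P_\lambda(x-\xi,y)f(\xi)\,d\xi$. Boundary function: it is known that an eigenfunction $u$ of $\Delta_{\mathbb{H}^n}$ with eigenvalue $-(\lambda^2+\rho^2)$, $\mathrm{Im}(\lambda)>0$, is of the form $u=P_\lambda f$ for some $f\in L^\infty(\mathbb{R}^{n-1})$ if and only if $\sup_{y>0}y^{\mathrm{Im}(\lambda)-\rho}\|u(\cdot,y)\|_{L^\infty(\mathbb{R}^{n-1})}<\infty$.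 This $f$ is called the boundary function of $u$. $B(x_0,r)$ is the Euclidean ball in $\mathbb{R}^{n-1}$ and $m$ is Lebesgue measure on $\mathbb{R}^{n-1}$. *)

(* Defs.v *)
From HB Require Import structures.
From mathcomp Require Import all_boot all_order all_algebra.
From mathcomp Require Import all_classical all_reals all_analysis.
From mathcomp Require Import complex.

Set Implicit Arguments.
Unset Strict Implicit.
Unset Printing Implicit Defensive.

Import Order.TTheory GRing.Theory Num.Theory.
Import numFieldNormedType.Exports.

Local Open Scope classical_set_scope.
Local Open Scope ring_scope.

(* Product (= Borel) sigma-algebra on row vectors, built as for tuples. *)
Definition rV_display : measure_display. Proof. exact. Qed.

Section rV_measurable.
Context {R : realType} (m : nat).

Let coor : 'I_m -> 'rV[R]_m -> measurableTypeR R := fun i x => x 0 i.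

Let rV_measurable : set (set 'rV[R]_m) := g_sigma_preimage coor.

Let rV_measurable0 : rV_measurable set0.
Proof. exact: sigma_algebra0. Qed.

Let rV_measurableC A : rV_measurable A -> rV_measurable (~` A).
Proof. exact: sigma_algebraC. Qed.

Let rV_measurable_bigcup (F : (set 'rV[R]_m)^nat) :
  (forall i, rV_measurable (F i)) -> rV_measurable (\bigcup_i (F i)).
Proof. exact: sigma_algebra_bigcup. Qed.

HB.instance Definition _ := @isMeasurable.Build rV_display
  'rV[R]_m rV_measurable rV_measurable0 rV_measurableC rV_measurable_bigcup.

Lemma measurable_coor (i : 'I_m) :
  measurable_fun [set: 'rV[R]_m] (fun x => x 0 i : measurableTypeR R).
Proof.
move=> _ Y mY; rewrite setTI; apply: sub_sigma_algebra => /=.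
rewrite -bigcup_seq/=; exists i => /=; first by rewrite mem_index_enum.
by exists Y => //; rewrite setTI.
Qed.

Lemma measurable_fun_coorP d (T : measurableType d) (f : T -> 'rV[R]_m) :
  (forall i, measurable_fun [set: T] (fun t => f t 0 i : measurableTypeR R)) ->
  measurable_fun [set: T] f.
Proof.
move=> mf.
have sub : g_sigma_preimage (fun i => coor i \o f) `<=` measurable.
  apply: smallest_sub; first exact: sigma_algebra_measurable.
  rewrite -bigcup_seq; apply: bigcup_sub => i _ A [B mB <-]; exact: mf.
rewrite g_sigma_preimage_comp in sub.
by move=> _ A mA; apply: sub; exists A.
Qed.

End rV_measurable.

Section rV_lebesgue_step.
Local Open Scope ereal_scope.
Context {R : realType} (m : nat).

Definition rV_cons (p : measurableTypeR R * 'rV[R]_m) : 'rV[R]_m.+1 :=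
  row_mx (p.1)%:M p.2.

Lemma rV_cons0 p : rV_cons p ord0 ord0 = p.1.
Proof.
rewrite /rV_cons (_ : ord0 = lshift m (ord0 : 'I_1)); last exact/val_inj.
by rewrite (@row_mxEl _ 1 1 m) mxE eqxx mulr1n.
Qed.

Lemma rV_consS p i : rV_cons p ord0 (lift ord0 i) = p.2 ord0 i.
Proof.
rewrite /rV_cons (_ : lift ord0 i = rshift 1 i); last exact/val_inj.
by rewrite (@row_mxEr _ 1 1 m).
Qed.

Lemma measurable_rV_cons : measurable_fun setT rV_cons.
Proof.
apply: measurable_fun_coorP => i; case: (unliftP ord0 i) => [j|] ->.
  under eq_fun do rewrite rV_consS.
  by apply: (@measurableT_comp _ _ _ _ _ _
    (fun x : 'rV[R]_m => x ord0 j : measurableTypeR R)) => //;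
    exact: measurable_coor.
under eq_fun do rewrite rV_cons0.
exact: measurable_fst.
Qed.

Variable mu : {sigma_finite_measure set 'rV[R]_m -> \bar R}.

Definition rV_lebesgue_step : set 'rV[R]_m.+1 -> \bar R :=
  pushforward (lebesgue_measure \x mu) rV_cons.

Let step0 : rV_lebesgue_step set0 = 0.
Proof. by rewrite /rV_lebesgue_step /pushforward preimage_set0 measure0. Qed.

Let step_ge0 A : 0 <= rV_lebesgue_step A.
Proof. by rewrite /rV_lebesgue_step /pushforward; exact: measure_ge0. Qed.

Let step_sigma_additive : semi_sigma_additive rV_lebesgue_step.
Proof.
move=> F mF tF mUF; rewrite /rV_lebesgue_step /pushforward preimage_bigcup.
apply: measure_semi_sigma_additive.
- by move=> n; rewrite -[X in measurable X]setTI; exact: measurable_rV_cons.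
- apply/trivIsetP => i j _ _ ij; rewrite -preimage_setI.
  by move/trivIsetP : tF => /(_ _ _ I I ij) ->; rewrite preimage_set0.
- by rewrite -preimage_bigcup -[X in measurable X]setTI;
    exact: measurable_rV_cons.
Qed.

HB.instance Definition _ := isMeasure.Build _ _ _ rV_lebesgue_step
  step0 step_ge0 step_sigma_additive.

Let rV_uncons (x : 'rV[R]_m.+1) : measurableTypeR R * 'rV[R]_m :=
  (x ord0 ord0, \row_i x ord0 (lift ord0 i)).

Let rV_consK : cancel rV_cons rV_uncons.
Proof.
move=> [t x]; rewrite /rV_uncons rV_cons0; congr pair.
by apply/rowP => i; rewrite mxE rV_consS.
Qed.

Let measurable_rV_uncons : measurable_fun setT rV_uncons.
Proof.
apply/measurable_fun_pairP; split; first exact: measurable_coor.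
apply: measurable_fun_coorP => i /=; under eq_fun do rewrite mxE.
exact: measurable_coor.
Qed.

Let rV_lebesgue_step_sigma_finite : sigma_finite setT rV_lebesgue_step.
Proof.
have /sigma_finiteP[F [FT ndF Foo]] := sigma_finiteT (@lebesgue_measure R).
have /sigma_finiteP[G [GT ndG Goo]] := sigma_finiteT mu.
exists (fun n => rV_uncons @^-1` (F n `*` G n)).
  apply/seteqP; split => // x _.
  have [k _ Fk] : (\bigcup_k F k) (rV_uncons x).1 by rewrite -FT.
  have [l _ Gl] : (\bigcup_k G k) (rV_uncons x).2 by rewrite -GT.
  exists (maxn k l) => //; split.
    by move: Fk; exact/subsetPset/ndF/leq_maxl.
  by move: Gl; exact/subsetPset/ndG/leq_maxr.
move=> n; have [mF Fn] := Foo n; have [mG Gn] := Goo n; split.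
  rewrite -[X in measurable X]setTI.
  by apply: measurable_rV_uncons => //; exact: measurableX.
rewrite /rV_lebesgue_step /pushforward -comp_preimage.
rewrite (_ : _ \o _ = id); last by apply/funext => p; exact: rV_consK.
by rewrite preimage_id product_measure1E// lte_mul_pinfty// ge0_fin_numE.
Qed.

HB.instance Definition _ := Measure_isSigmaFinite.Build _ _ _ rV_lebesgue_step
  rV_lebesgue_step_sigma_finite.

End rV_lebesgue_step.

(* Lebesgue measure on R^m as the m-fold product of the one on R, transported
   to row vectors along rV_cons; see rV_lebesgue_box for its value on boxes. *)
Fixpoint rV_lebesgue (R : realType) (m : nat) :
    {sigma_finite_measure set 'rV[R]_m -> \bar R} :=
  match m return {sigma_finite_measure set 'rV[R]_m -> \bar R} with
  | 0 => \d_(0 : 'rV[R]_0)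
  | k.+1 => rV_lebesgue_step (rV_lebesgue R k)
  end.

Lemma rV_lebesgue_box (R : realType) (m : nat) (a b : 'rV[R]_m) :
  (forall i, a ord0 i <= b ord0 i) ->
  rV_lebesgue R m [set x | forall i, x ord0 i \in `[a ord0 i, b ord0 i]] =
  (\prod_i (b ord0 i - a ord0 i))%:E.
Proof.
elim: m a b => [|m IH] a b ab.
  by rewrite big_ord0 /= diracE mem_set// => -[].
pose tl (c : 'rV[R]_m.+1) : 'rV[R]_m := \row_i c ord0 (lift ord0 i).
have mbox k (c d : 'rV[R]_k) :
    measurable [set x : 'rV[R]_k | forall i, x ord0 i \in `[c ord0 i, d ord0 i]].
  rewrite (_ : [set _ | _] = \bigcap_i
      ((fun x : 'rV[R]_k => x ord0 i) @^-1` `[c ord0 i, d ord0 i])); last first.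
    by apply/seteqP; split => x/= xcd i; [move=> _|]; exact: xcd.
  apply: fin_bigcap_measurable => // i _; rewrite -[X in measurable X]setTI.
  by apply: measurable_coor => //; exact: measurable_itv.
have -> : rV_lebesgue R m.+1
    [set x | forall i, x ord0 i \in `[a ord0 i, b ord0 i]] =
  (lebesgue_measure \x rV_lebesgue R m)%E (`[a ord0 ord0, b ord0 ord0]%classic
    `*` [set x : 'rV[R]_m | forall i, x ord0 i \in `[tl a ord0 i, tl b ord0 i]]).
  congr ((lebesgue_measure \x rV_lebesgue R m)%E _).
  apply/seteqP; split => [[t x]/= H|[t x]/= [Ht Hx] i].
    split; first by have := H ord0; rewrite rV_cons0.
    by move=> i; have := H (lift ord0 i); rewrite rV_consS !mxE.
  case: (unliftP ord0 i) => [j|] ->; last by rewrite rV_cons0.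
  by rewrite rV_consS; have := Hx j; rewrite !mxE.
rewrite product_measure1E//=; last exact: mbox.
rewrite lebesgue_measure_itv/= lte_fin IH; last by move=> i; rewrite !mxE.
rewrite big_ord_recl; under eq_bigr do rewrite !mxE.
case: ltP => [_|ba]; first by rewrite -EFinB -EFinM.
have -> : b ord0 ord0 = a ord0 ord0 by apply/eqP; rewrite eq_le ba ab.
by rewrite subrr mul0r mul0e.
Qed.

Local Open Scope complex_scope.

Section complex_analysis.
Context {R : realType}.

Definition cexp (z : R[i]) : R[i] :=
  (expR (complex.Re z) * cos (complex.Im z)) +i*
  (expR (complex.Re z) * sin (complex.Im z)).

(* y ^ z = exp (z log y); only meaningful for 0 < y. *)
Definition cpow (y : R) (z : R[i]) : R[i] := cexp (z * (ln y)%:C).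

Definition cmeasurable_fun d (T : measurableType d) (f : T -> R[i]) : Prop :=
  measurable_fun [set: T] (fun x => complex.Re (f x)) /\
  measurable_fun [set: T] (fun x => complex.Im (f x)).

Definition cintegral d (T : measurableType d) (mu : {measure set T -> \bar R})
    (D : set T) (f : T -> R[i]) : R[i] :=
  (\int[mu]_(x in D) complex.Re (f x)) +i* (\int[mu]_(x in D) complex.Im (f x)).

Definition Linfty_norm m (f : 'rV[R]_m -> R[i]) : \bar R :=
  Lnorm (rV_lebesgue R m) +oo%E (fun x => (Normc.normc (f x))%:E).

Definition Linfty m (f : 'rV[R]_m -> R[i]) : Prop :=
  cmeasurable_fun f /\ (Linfty_norm f < +oo)%E.

(* The library norm on row vectors is the sup norm. *)
Definition enorm m (x : 'rV[R]_m) : R := Num.sqrt (\sum_i x ord0 i ^+ 2).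

Definition eball m (x0 : 'rV[R]_m) (r : R) : set 'rV[R]_m :=
  [set x | enorm (x - x0) < r].

Definition ball_average m (f : 'rV[R]_m -> R[i]) (x0 : 'rV[R]_m) (r : R) :
    R[i] :=
  ((fine (rV_lebesgue R m (eball x0 r)))^-1)%:C *
  cintegral (rV_lebesgue R m) (eball x0 r) f.

End complex_analysis.

(* Functions on the upper half space H^n are represented by functions on
   R^(n-1) x R; all notions below only depend on their values at (x, y) with
   0 < y. *)
Section hyperbolic.
Context {R : realType} (n : nat).
Implicit Types (p : 'rV[R]_n.-1 * R) (lam : R[i]).

Definition rho : R := (n%:R - 1) / 2.

Definition upper_half_space : set ('rV[R]_n.-1 * R) := [set p | 0 < p.2].

(* Coordinate directions: Some i for x_i, None for y. *)
Definition dir (i : option 'I_n.-1) : 'rV[R]_n.-1 * R :=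
  if i is Some j then (delta_mx ord0 j, 0) else (0, 1).

(* Twice continuously differentiable on H^n: all partial derivatives of order at
   most 2 exist and are continuous. *)
Definition C2 (g : 'rV[R]_n.-1 * R -> R) : Prop :=
  forall p, upper_half_space p ->
    {for p, continuous g} /\
    forall i, [/\ derivable g p (dir i), {for p, continuous ('D_(dir i) g)} &
      forall j, derivable ('D_(dir i) g) p (dir j) /\
                {for p, continuous ('D_(dir j) ('D_(dir i) g))}].

Definition real_laplacian (g : 'rV[R]_n.-1 * R -> R) p : R :=
  p.2 ^+ 2 * (\sum_(j < n.-1) 'D_(dir (Some j)) ('D_(dir (Some j)) g) p
              + 'D_(dir None) ('D_(dir None) g) p)
  - (n%:R - 2) * p.2 * 'D_(dir None) g p.

Definition hyp_laplacian (u : 'rV[R]_n.-1 * R -> R[i]) p : R[i] :=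
  real_laplacian (fun q => complex.Re (u q)) p +i*
  real_laplacian (fun q => complex.Im (u q)) p.

Definition hyp_eigenfunction (u : 'rV[R]_n.-1 * R -> R[i]) (mu : R[i]) : Prop :=
  [/\ C2 (fun q => complex.Re (u q)), C2 (fun q => complex.Im (u q)) &
      forall p, upper_half_space p -> hyp_laplacian u p = mu * u p].

Definition unnormalized_poisson lam p : R[i] :=
  cpow (p.2 / (p.2 ^+ 2 + enorm p.1 ^+ 2)) (rho%:C - 'i%C * lam).

(* The constant d such that d times the unnormalized kernel has integral 1 at
   height y = 1; when Im lam > 0 it exists and is unique. *)
Definition poisson_const lam : R[i] :=
  xget 0 [set d : R[i] | cintegral (rV_lebesgue R n.-1) setT
    (fun x => d * unnormalized_poisson lam (x, 1)) = 1].

Definition poisson_kernel lam p : R[i] :=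
  poisson_const lam * unnormalized_poisson lam p.

Definition poisson_transform lam (f : 'rV[R]_n.-1 -> R[i]) p : R[i] :=
  cintegral (rV_lebesgue R n.-1) setT
    (fun xi => poisson_kernel lam (p.1 - xi, p.2) * f xi).

(* sup over y > 0 of y^(Im lam - rho) ||u(., y)||_oo, as an extended real. *)
Definition growth_norm lam (u : 'rV[R]_n.-1 * R -> R[i]) : \bar R :=
  ereal_sup [set ((y `^ (complex.Im lam - rho))%:E *
                  Linfty_norm (fun x => u (x, y)))%E | y in [set y : R | 0 < y]].

Definition boundary_function lam (u : 'rV[R]_n.-1 * R -> R[i])
    (f : 'rV[R]_n.-1 -> R[i]) : Prop :=
  Linfty f /\ forall p, upper_half_space p -> u p = poisson_transform lam f p.

End hyperbolic.
Arguments rho {R} n.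

(* Main.v *)
Require Import Defs.
From mathcomp Require Import all_boot all_order all_algebra.
From mathcomp Require Import all_classical all_reals all_analysis.
From mathcomp Require Import complex.
From mathcomp Require Import measurable_realfun ess_sup_inf ring.

(* Write [m = n - 1], [s = rho - i lam] and [sigma = Re s > m / 2]. Up to the
   constant factor [poisson_const], which is inverse to the integral of
   [(1 + |x|^2)^-s], the quantity [y^-(rho + i lam) u (x0, y)] is the dilated mean
   [y^-m \int g (|x - x0|^2 / y^2) f x dx] of [f] for the profile
   [g r = (1 + r)^-s], while the ball average is, up to a constant, the dilated
   mean for the profile [1_{r < 1}]. Replacing [f] by [f - L], it is enough to
   show that one dilated mean tends to [0] if and only if the other does.

   The profiles [g = O((1 + r)^-sigma)] whose dilated mean tends to [0] form a
   linear space, stable under dilations [g (c r)] and under pointwise limits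
   dominated by a multiple of [(1 + r)^-sigma].
   - If it contains [1_{r < 1}], it contains every [1_{r < t}], hence step
     approximations of [(1 + r)^-s], hence [(1 + r)^-s].
   - If it contains [(1 + r)^-s], then difference quotients in the dilation
     parameter give [(1 + r)^-(s + k)] for all natural [k], that is
     [(1 + r)^-s P(1 / (1 + r))] for all polynomials [P]. Indicators of
     [1 / (1 + r) > theta] are bounded limits of such polynomials, which gives
     [(1 + r)^-s 1_{r < t}], and step approximations of [(1 + r)^s 1_{r < 1}]
     then give [1_{r < 1}].
   This replaces Wiener's Tauberian theorem. Applied to [f = 1], the second
   implication also shows that the integral of [(1 + |x|^2)^-s] is nonzero. *)

Set Implicit Arguments.
Unset Strict Implicit.
Unset Printing Implicit Defensive.

Import Order.TTheory GRing.Theory Num.Theory.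
Import numFieldNormedType.Exports.

Local Open Scope classical_set_scope.
Local Open Scope ring_scope.
Local Open Scope complex_scope.

(** * Affine changes of variables *)

Section affine.
Context {R : realType}.
Implicit Types (a : R).

Let affine1 a (b : R) : measurableTypeR R -> measurableTypeR R := fun t => a * t + b.

Let measurable_affine1 a b : measurable_fun setT (affine1 a b).
Proof.
apply: measurable_funD => //; apply: measurable_funM => //.
Qed.

(** Lebesgue measure is determined by its values on the intervals []c, d]], and the scaled
    pushforward gives each of them its length. *)
Lemma lebesgue_measure_affine a (b : R) (A : set (measurableTypeR R)) :
  0 < a -> measurable A ->
  lebesgue_measure A =
  (a%:E * lebesgue_measure ((fun t : R => (a * t + b)%R) @^-1` A))%E.
Proof.
move=> a0 mA.
pose a' := NngNum (ltW a0).
have mf := measurable_affine1 a b.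
pose nu := mscale a' (pushforward lebesgue_measure (affine1 a b)).
transitivity (nu mf A) => //.
apply: lebesgue_measure_unique mA => _ [[c d]] _ <-.
rewrite /nu /= /mscale /= /pushforward.
rewrite (_ : affine1 a b @^-1` _ = `](c - b) / a, (d - b) / a]%classic); last first.
  apply/seteqP; split => t; rewrite /affine1 /= !in_itv/=;
  by rewrite ltr_pdivrMr// ler_pdivlMr// ltrBlDr lerBrDr mulrC.
rewrite !lebesgue_measure_itv/= !lte_fin ltr_pM2r ?invr_gt0// ltrD2r.
case: ifP => _; last by rewrite mule0.
rewrite -!EFinB -EFinM -mulrBl mulrCA divff ?gt_eqF// mulr1; congr EFin; ring.
Qed.

Lemma measurable_affine m a (b : 'rV[R]_m) :
  measurable_fun setT (fun x : 'rV[R]_m => a *: x + b).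
Proof.
apply: measurable_fun_coorP => i; under eq_fun do rewrite !mxE.
exact: (measurableT_comp (measurable_affine1 a (b 0 i)) (measurable_coor i)).
Qed.

(** Induction on the dimension: on a rectangle the first coordinate and the remaining ones scale
    separately, by [a] and [a ^+ m], and a product measure is determined by its values on
    rectangles. *)
Lemma rV_lebesgue_affine m a (b : 'rV[R]_m) (A : set 'rV[R]_m) :
  0 < a -> measurable A ->
  rV_lebesgue R m A =
  ((a ^+ m)%:E * rV_lebesgue R m ((fun x => (a *: x + b)%R) @^-1` A))%E.
Proof.
move=> a0; elim: m b A => [|m IH] b A mA.
  rewrite expr0 mul1e /=; congr (\d__ _).
  by apply/seteqP; split => x /=; rewrite (_ : _ *: x + b = x)//; apply/rowP => -[].
have am0 : 0 <= a ^+ m.+1 by rewrite exprn_ge0// ltW.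
pose am := NngNum am0.
pose b' : 'rV[R]_m := \row_i b ord0 (lift ord0 i).
pose phi (p : measurableTypeR R * 'rV[R]_m) : measurableTypeR R * 'rV[R]_m :=
  (affine1 a (b ord0 ord0) p.1, a *: p.2 + b').
have mphi : measurable_fun setT phi.
  apply/measurable_fun_pairP; split.
    apply: (measurableT_comp (measurable_affine1 a (b ord0 ord0))).
    exact: measurable_fst.
  apply: (measurableT_comp (measurable_affine a b')); exact: measurable_snd.
pose nu := mscale am (pushforward (lebesgue_measure \x rV_lebesgue R m)%E phi).
have mcA : measurable (@rV_cons R m @^-1` A).
  by rewrite -[X in measurable X]setTI; exact: measurable_rV_cons.
transitivity (nu mphi (@rV_cons R m @^-1` A)); last first.
  rewrite /nu /= /mscale /= /pushforward; congr (_ * (_ \x _) _)%E.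
  apply/seteqP; split => p /=;
  rewrite (_ : rV_cons (phi p) = a *: rV_cons p + b)//;
  apply/rowP => i; rewrite [RHS]mxE [X in X + _]mxE;
  case: (unliftP ord0 i) => [j|] ->; by rewrite ?rV_consS ?rV_cons0 // !mxE.
rewrite /= /rV_lebesgue_step /pushforward.
apply: product_measure_unique mcA => B C mB mC.
rewrite /nu /= /mscale /= /pushforward.
rewrite (_ : phi @^-1` (B `*` C) =
  ((fun t : R => a * t + b ord0 ord0) @^-1` B) `*`
  ((fun x => a *: x + b') @^-1` C)); last by apply/seteqP; split.
have mB' : measurable ((fun t : R => a * t + b ord0 ord0) @^-1` B).
  rewrite -[X in measurable X]setTI.
  exact: (measurable_affine1 a (b ord0 ord0)).
rewrite product_measure1E//; last first.
  by rewrite -[X in measurable X]setTI; exact: measurable_affine.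
rewrite (@lebesgue_measure_affine a (b ord0 ord0) B)// (IH b' C)//.
by rewrite exprS EFinM muleACA.
Qed.

Lemma ge0_integral_rV_affine m a (b : 'rV[R]_m) (h : 'rV[R]_m -> \bar R) :
  0 < a -> measurable_fun setT h -> (forall x, 0 <= h x)%E ->
  (\int[rV_lebesgue R m]_x h x =
   (a ^+ m)%:E * \int[rV_lebesgue R m]_x h (a *: x + b)%R)%E.
Proof.
move=> a0 mh h0.
have am0 : 0 <= a ^+ m by rewrite exprn_ge0// ltW.
pose am := NngNum am0.
have mf := measurable_affine a b.
pose nu := mscale am (pushforward (rV_lebesgue R m) (fun x => a *: x + b)).
rewrite (eq_measure_integral (nu mf)).
  rewrite ge0_integral_mscale//=; congr (_ * _)%E.
  by rewrite ge0_integral_pushforward ?preimage_setT//.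
by move=> A mA _; exact: (rV_lebesgue_affine b a0 mA).
Qed.

Lemma integrable_rV_affine m a (b : 'rV[R]_m) (h : 'rV[R]_m -> R) :
  0 < a -> (rV_lebesgue R m).-integrable setT (EFin \o h) ->
  (rV_lebesgue R m).-integrable setT (EFin \o (fun x => h (a *: x + b))).
Proof.
move=> a0 /integrableP[mh hoo]; apply/integrableP; split.
  exact: (measurableT_comp mh (measurable_affine a b)).
move: hoo; rewrite (@ge0_integral_rV_affine _ a b)//=; last first.
  by apply/measurable_EFinP; apply: measurableT_comp => //; apply/measurable_EFinP.
case: (\int[_]_x _)%E => [r| |]; rewrite ?ltry ?ltNyr//.
by rewrite gt0_muley ?lte_fin ?exprn_gt0.
Qed.

(** The nonnegative case applies to the positive and negative parts; integrability makes both
    integrals finite, so the factor [a ^+ m] distributes over their difference. *)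
Lemma Rintegral_rV_affine m a (b : 'rV[R]_m) (h : 'rV[R]_m -> R) :
  0 < a -> (rV_lebesgue R m).-integrable setT (EFin \o h) ->
  \int[rV_lebesgue R m]_x h (a *: x + b) =
  a ^- m * \int[rV_lebesgue R m]_x h x.
Proof.
move=> a0 ih; have ih' := integrable_rV_affine b a0 ih.
have [mh _] := integrableP _ _ _ ih.
have am : a ^+ m != 0 by rewrite expf_neq0// gt_eqF.
apply: (mulfI am); rewrite mulrA mulfV// mul1r.
pose F := EFin \o h; pose G := EFin \o (fun x => h (a *: x + b)).
have E : (\int[rV_lebesgue R m]_x F x = (a ^+ m)%:E * \int[rV_lebesgue R m]_x G x)%E.
  have pE := ge0_integral_rV_affine b a0 (measurable_funepos mh) (fun=> funepos_ge0 _ _).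
  have nE := ge0_integral_rV_affine b a0 (measurable_funeneg mh) (fun=> funeneg_ge0 _ _).
  rewrite [LHS]integralE [X in (_ = _ * X)%E]integralE pE nE.
  rewrite (_ : (fun x => F^\+ (a *: x + b)%R)%E = G^\+%E); last first.
    by apply/funext => x; rewrite !funeposE.
  rewrite (_ : (fun x => F^\- (a *: x + b)%R)%E = G^\-%E); last first.
    by apply/funext => x; rewrite !funenegE.
  have := integrable_pos_fin_num measurableT ih'.
  have := integrable_neg_fin_num measurableT ih'.
  rewrite -/G; case: (\int[_]_x G^\- x)%E => // p _.
  by case: (\int[_]_x G^\+ x)%E => // q _; congr EFin; rewrite /=; ring.
rewrite /Rintegral [in RHS]E fineM//.
exact: integrable_fin_num ih'.
Qed.

End affine.

(** * Complex numbers and complex powers *)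

Section complex_numbers.
Context {R : realType}.
Implicit Types (z w : R[i]) (x y t : R).

Lemma complex_eq z w :
  complex.Re z = complex.Re w -> complex.Im z = complex.Im w -> z = w.
Proof. by move=> rzw izw; apply/eqP; rewrite eq_complex rzw izw !eqxx. Qed.

Lemma Re_mulc z w : complex.Re (z * w) =
  complex.Re z * complex.Re w - complex.Im z * complex.Im w.
Proof. by case: z; case: w. Qed.

Lemma Im_mulc z w : complex.Im (z * w) =
  complex.Re z * complex.Im w + complex.Im z * complex.Re w.
Proof. by case: z; case: w. Qed.

Lemma Re_addc z w : complex.Re (z + w) = complex.Re z + complex.Re w.
Proof. by case: z; case: w. Qed.

Lemma Im_addc z w : complex.Im (z + w) = complex.Im z + complex.Im w.
Proof. by case: z; case: w. Qed.

Lemma normc_ge0 z : 0 <= Normc.normc z.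
Proof. by case: z => a b; exact: sqrtr_ge0. Qed.

Lemma normc_triangle z w : Normc.normc (z + w) <= Normc.normc z + Normc.normc w.
Proof. exact: (@le_normcD _ (z : Rcomplex R) w). Qed.

Lemma normc_opp z : Normc.normc (- z) = Normc.normc z.
Proof. exact: (@normcN _ (z : Rcomplex R)). Qed.

Lemma le_Re_normc z : `|complex.Re z| <= Normc.normc z.
Proof.
case: z => a b /=; rewrite -sqrtr_sqr ler_sqrt ?lerDl ?sqr_ge0//.
by rewrite addr_ge0 ?sqr_ge0.
Qed.

Lemma le_Im_normc z : `|complex.Im z| <= Normc.normc z.
Proof.
case: z => a b /=; rewrite -sqrtr_sqr ler_sqrt ?lerDr ?sqr_ge0//.
by rewrite addr_ge0 ?sqr_ge0.
Qed.

Lemma normc_real x : Normc.normc x%:C = `|x|.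
Proof. by rewrite /= expr0n addr0 sqrtr_sqr. Qed.

Lemma normc_le_ReIm z :
  Normc.normc z <= `|complex.Re z| + `|complex.Im z|.
Proof.
case: z => a b /=; rewrite -[leRHS]ger0_norm ?addr_ge0//.
rewrite -sqrtr_sqr ler_sqrt ?sqr_ge0// sqrrD !real_normK ?num_real//.
by rewrite -subr_ge0 (_ : _ - _ = `|a| * `|b| *+ 2); [rewrite mulrn_wge0 ?mulr_ge0|ring].
Qed.

Lemma cexpD z w : cexp (z + w) = cexp z * cexp w.
Proof.
rewrite /cexp Re_addc Im_addc expRD cosD sinD; apply: complex_eq; rewrite /=; ring.
Qed.

Lemma cexp0 : cexp (0 : R[i]) = 1.
Proof. by rewrite /cexp /= expR0 cos0 sin0 mulr1 mulr0. Qed.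

Lemma normc_cexp z : Normc.normc (cexp z) = expR (complex.Re z).
Proof.
rewrite /= !exprMn -mulrDr cos2Dsin2 mulr1 sqrtr_sqr ger0_norm ?expR_ge0//.
Qed.

Lemma cpowM x y z : 0 < x -> 0 < y -> cpow (x * y) z = cpow x z * cpow y z.
Proof.
move=> x0 y0; rewrite /cpow lnM ?posrE// -cexpD -mulrDr.
by congr (cexp (_ * _)); apply: complex_eq; rewrite /= ?addr0.
Qed.

Lemma cpowD x z w : cpow x (z + w) = cpow x z * cpow x w.
Proof. by rewrite /cpow mulrDl cexpD. Qed.

Lemma cpow_neq0 x z : cpow x z != 0.
Proof.
apply/eqP => /(congr1 (@Normc.normc R)); rewrite normc_cexp Normc.normc0 => /eqP.
by rewrite gt_eqF// expR_gt0.
Qed.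

Lemma cpowN x z : cpow x (- z) = (cpow x z)^-1.
Proof.
apply: (mulfI (cpow_neq0 x z)); rewrite mulfV ?cpow_neq0// -cpowD subrr.
by rewrite /cpow mul0r cexp0.
Qed.

Lemma cpowV x z : 0 < x -> cpow x^-1 z = cpow x (- z).
Proof.
move=> x0; rewrite /cpow lnV ?posrE//; congr cexp.
by case: z => a b; apply: complex_eq; rewrite /=; ring.
Qed.

Lemma cpow_real x t : cpow x t%:C = (expR (t * ln x))%:C.
Proof.
by rewrite /cpow /cexp /= !(mul0r, mulr0, subr0, addr0) cos0 sin0 mulr1 mulr0.
Qed.

Lemma cpow_nat x k : 0 < x -> cpow x k%:R = (x ^+ k)%:C.
Proof.
move=> x0; rewrite (_ : k%:R = (k%:R : R)%:C); last by rewrite rmorph_nat.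
by rewrite cpow_real expRM_natl lnK// posrE.
Qed.

Lemma normc_cpow x z : 0 < x -> Normc.normc (cpow x z) = x `^ complex.Re z.
Proof.
move=> x0; rewrite /cpow normc_cexp Re_mulc /= mulr0 subr0 /powR gt_eqF//.
Qed.

(** In the partial order of [R[i]] a positive [e] has zero imaginary part, so radii in [R]
    suffice. *)
Lemma ccvgP T (F : set_system T) (FF : Filter F) (f : T -> R[i]) (L : R[i]) :
  ((f x : R[i]^o) @[x --> F] --> (L : R[i]^o)) <->
  (forall e : R, 0 < e -> \forall x \near F, Normc.normc (f x - L) < e).
Proof.
split.
  move=> /cvgrPdist_lt H e e0.
  have /H : 0 < e%:C by rewrite ltcE /= eqxx.
  apply: filterS => x; rewrite /= ltcE /= => /andP[_].
  by rewrite -[L - f x]opprB normc_opp.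
move=> H; apply/cvgrPdist_lt => e e0.
have e0' : 0 < complex.Re e by move: e0; rewrite ltcE => /andP[].
have := H _ e0'; apply: filterS => x.
move: e0; rewrite ltcE /= => /andP[/eqP eI _] lte.
by rewrite ltcE /= eI eqxx -[L - f x]opprB normc_opp.
Qed.

End complex_numbers.

(** * Integrals of complex functions *)

Section complex_integral.
Context d (T : measurableType d) {R : realType}.
Variable mu : {measure set T -> \bar R}.
Implicit Types (F H : T -> R[i]) (G : T -> R) (c : R[i]).

Definition cintegrable F : Prop :=
  mu.-integrable setT (fun x => (complex.Re (F x))%:E) /\
  mu.-integrable setT (fun x => (complex.Im (F x))%:E).

Lemma cintegrableD F H :
  cintegrable F -> cintegrable H -> cintegrable (fun x => F x + H x).
Proof.
move=> [rF iF] [rH iH]; split.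
  by under eq_fun do rewrite Re_addc EFinD; exact: integrableD.
by under eq_fun do rewrite Im_addc EFinD; exact: integrableD.
Qed.

Lemma cintegralD F H : cintegrable F -> cintegrable H ->
  cintegral mu setT (fun x => F x + H x) =
  cintegral mu setT F + cintegral mu setT H.
Proof.
move=> [rF iF] [rH iH]; apply: complex_eq; rewrite /= /cintegral /=.
  by under eq_Rintegral do rewrite Re_addc; rewrite RintegralD.
by under eq_Rintegral do rewrite Im_addc; rewrite RintegralD.
Qed.

Lemma cintegrableZ c F : cintegrable F -> cintegrable (fun x => c * F x).
Proof.
move=> [rF iF]; split.
  under eq_fun do rewrite Re_mulc EFinB !EFinM.
  by apply: integrableB => //; exact: integrableZl.
under eq_fun do rewrite Im_mulc EFinD !EFinM.
by apply: integrableD => //; exact: integrableZl.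
Qed.

Lemma cintegralZ c F : cintegrable F ->
  cintegral mu setT (fun x => c * F x) = c * cintegral mu setT F.
Proof.
move=> [rF iF].
have iZ (k : R) (f : T -> R) : mu.-integrable setT (EFin \o f) ->
    mu.-integrable setT (EFin \o (fun x => k * f x)).
  by move=> fi; rewrite /comp; under eq_fun do rewrite EFinM; exact: integrableZl.
apply: complex_eq; rewrite ?Re_mulc ?Im_mulc /=.
  under eq_Rintegral do rewrite Re_mulc.
  by rewrite RintegralB ?RintegralZl//; apply: iZ.
under eq_Rintegral do rewrite Im_mulc.
by rewrite RintegralD ?RintegralZl//; apply: iZ.
Qed.

(** The bound is asked only almost everywhere, because an essentially bounded function satisfies its
    bound only off a null set. *)
Let ae_integrable_le (f : T -> R) G : measurable_fun setT f ->
  mu.-integrable setT (EFin \o G) -> {ae mu, forall x, `|f x| <= G x} ->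
  mu.-integrable setT (EFin \o f).
Proof.
move=> mf iG fG; have [mG Goo] := integrableP _ _ _ iG.
apply/integrableP; split; first exact/measurable_EFinP.
apply: le_lt_trans Goo; apply: ae_ge0_le_integral => //=.
- by apply/measurable_EFinP; exact: measurableT_comp.
- by apply/measurable_EFinP; apply: measurableT_comp => //; apply/measurable_EFinP.
- by apply: filterS fG => x fx _; rewrite lee_fin (le_trans fx)// ler_norm.
Qed.

Let ae_Rintegral_le (f : T -> R) G : measurable_fun setT f ->
  mu.-integrable setT (EFin \o G) -> {ae mu, forall x, `|f x| <= G x} ->
  `|\int[mu]_x f x| <= \int[mu]_x G x.
Proof.
move=> mf iG fG; have fi := ae_integrable_le mf iG fG.
have [mG Goo] := integrableP _ _ _ iG.
apply: (le_trans (le_normr_Rintegral measurableT fi)).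
have nfi : mu.-integrable setT (EFin \o (fun x => `|f x|)).
  exact: (integrable_norm fi).
rewrite /Rintegral; apply: fine_le.
- exact: integrable_fin_num nfi.
- exact: integrable_fin_num iG.
have G0 : {ae mu, forall x, 0 <= G x}.
  by apply: filterS fG => x; exact: le_trans.
(* [G] is known to be nonnegative only almost everywhere, so its integral is first replaced by that
   of its absolute value. *)
rewrite [leRHS](ae_eq_integral (fun x => `|G x|%:E))//.
- apply: ae_ge0_le_integral => //=.
  + by apply/measurable_EFinP; exact: measurableT_comp.
  + by apply/measurable_EFinP; apply: measurableT_comp => //; apply/measurable_EFinP.
  + by apply: filterS fG => x fx _; rewrite lee_fin (le_trans fx)// ler_norm.
- by apply/measurable_EFinP; apply: measurableT_comp => //; apply/measurable_EFinP.
- by apply: filterS G0 => x Gx _; rewrite /= ger0_norm.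
Qed.

Lemma cintegrable_le F G : cmeasurable_fun F ->
  mu.-integrable setT (EFin \o G) -> {ae mu, forall x, Normc.normc (F x) <= G x} ->
  cintegrable F.
Proof.
move=> [mr mi] iG FG; split; apply: (ae_integrable_le _ iG) => //;
  apply: filterS FG => x; apply: le_trans; [exact: le_Re_normc|exact: le_Im_normc].
Qed.

(** The factor 2 comes from bounding the real and imaginary parts separately. *)
Lemma normc_cintegral_le F G : cmeasurable_fun F ->
  mu.-integrable setT (EFin \o G) -> {ae mu, forall x, Normc.normc (F x) <= G x} ->
  Normc.normc (cintegral mu setT F) <= 2 * \int[mu]_x G x.
Proof.
move=> [mr mi] iG FG; apply: le_trans (normc_le_ReIm _) _.
rewrite mulr_natl mulr2n; apply: lerD; apply: ae_Rintegral_le => //;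
  apply: filterS FG => x; apply: le_trans; [exact: le_Re_normc|exact: le_Im_normc].
Qed.

Lemma cintegral_mkcond D F :
  cintegral mu D F = cintegral mu setT (fun x => (x \in D)%:R * F x).
Proof.
rewrite /cintegral; congr (_ +i* _); rewrite Rintegral_mkcond;
  apply: eq_Rintegral => x _; rewrite patchE; case: (x \in D);
  by rewrite ?mulr1n ?mulr0n ?mul1r ?mul0r.
Qed.

Lemma cmeasurableM F H : cmeasurable_fun F -> cmeasurable_fun H ->
  cmeasurable_fun (fun x => F x * H x).
Proof.
move=> [rF iF] [rH iH]; split.
  under eq_fun do rewrite Re_mulc.
  by apply: measurable_funB; exact: measurable_funM.
under eq_fun do rewrite Im_mulc.
by apply: measurable_funD; exact: measurable_funM.
Qed.

Lemma cmeasurableD F H : cmeasurable_fun F -> cmeasurable_fun H ->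
  cmeasurable_fun (fun x => F x + H x).
Proof.
move=> [rF iF] [rH iH]; split.
  by under eq_fun do rewrite Re_addc; exact: measurable_funD.
by under eq_fun do rewrite Im_addc; exact: measurable_funD.
Qed.

Lemma cmeasurable_cst c : cmeasurable_fun (fun _ : T => c).
Proof. by split. Qed.

Lemma measurable_normc F : cmeasurable_fun F ->
  measurable_fun setT (fun x => Normc.normc (F x)).
Proof.
move=> [rF iF].
rewrite (_ : (fun x => _) = (fun x => (complex.Re (F x) ^+ 2
    + complex.Im (F x) ^+ 2) `^ 2^-1)); last first.
  apply/funext => x; rewrite powR12_sqrt ?addr_ge0 ?sqr_ge0//.
  by case: (F x).
apply: (measurableT_comp (measurable_powR _)).
by apply: measurable_funD; exact: measurable_funX.
Qed.

End complex_integral.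

Section complex_integral_rV.
Context {R : realType}.

Lemma cmeasurableT_comp d1 d2 (T1 : measurableType d1) (T2 : measurableType d2)
  (F : T2 -> R[i]) (g : T1 -> T2) :
  cmeasurable_fun F -> measurable_fun setT g -> cmeasurable_fun (F \o g).
Proof.
by move=> [rF iF] mg; split; [exact: (measurableT_comp rF)|exact: (measurableT_comp iF)].
Qed.

Lemma cintegral_rV_affine m (a : R) (b : 'rV[R]_m) (F : 'rV[R]_m -> R[i]) :
  0 < a -> cintegrable (rV_lebesgue R m) F ->
  cintegral (rV_lebesgue R m) setT (fun x => F (a *: x + b)) =
  (a ^- m)%:C * cintegral (rV_lebesgue R m) setT F.
Proof.
move=> a0 [rF iF]; apply: complex_eq; rewrite /cintegral.
  rewrite Re_mulc /= mul0r subr0.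
  exact: (@Rintegral_rV_affine R m a b (fun x => complex.Re (F x))).
rewrite Im_mulc /= mul0r addr0.
exact: (@Rintegral_rV_affine R m a b (fun x => complex.Im (F x))).
Qed.

End complex_integral_rV.

(** * Balls and integrable weights *)

Section euclidean_norm.
Context {R : realType}.
Variable m : nat.
Implicit Types (x : 'rV[R]_m).

Lemma enorm_ge0 x : 0 <= enorm x.
Proof. exact: sqrtr_ge0. Qed.

Lemma enorm_sqr x : enorm x ^+ 2 = \sum_i x ord0 i ^+ 2.
Proof. by rewrite sqr_sqrtr// sumr_ge0// => i _; rewrite sqr_ge0. Qed.

Lemma enorm_sqrZ (a : R) x : enorm (a *: x) ^+ 2 = a ^+ 2 * enorm x ^+ 2.
Proof.
by rewrite !enorm_sqr mulr_sumr; apply: eq_bigr => i _; rewrite mxE exprMn.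
Qed.

Lemma measurable_enorm_sqr : measurable_fun setT (fun x => enorm x ^+ 2).
Proof.
under eq_fun do rewrite enorm_sqr.
apply: measurable_sum => i; apply: measurable_funX; exact: measurable_coor.
Qed.

Lemma eball_sqr x (r : R) : 0 < r ->
  eball x r = [set y | enorm (y - x) ^+ 2 < r ^+ 2].
Proof.
move=> r0; apply/seteqP; split => y; rewrite /eball /=;
  by rewrite ltr_pXn2r// nnegrE ?enorm_ge0// ltW.
Qed.

Lemma measurable_eball x (r : R) : 0 < r -> measurable (eball x r).
Proof.
move=> r0; rewrite eball_sqr//.
have mf : measurable_fun setT (fun y : 'rV[R]_m => enorm (y - x) ^+ 2).
  apply: (measurableT_comp measurable_enorm_sqr).
  rewrite (_ : (fun y : 'rV[R]_m => y - x) = (fun y => 1 *: y + - x)).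
    exact: measurable_affine.
  by apply/funext => y; rewrite scale1r.
rewrite [X in measurable X](_ : _ =
  (fun y : 'rV[R]_m => enorm (y - x) ^+ 2) @^-1` `]-oo, r ^+ 2[); last first.
  by apply/seteqP; split => y /=; rewrite in_itv.
by rewrite -[X in measurable X]setTI; apply: mf => //; exact: measurable_itv.
Qed.

Let box (t : R) : set 'rV[R]_m :=
  [set x | forall i, x ord0 i \in `[(const_mx (- t) : 'rV[R]_m) ord0 i,
                                  (const_mx t : 'rV[R]_m) ord0 i]].

Let measurable_box t : measurable (box t).
Proof.
rewrite (_ : box t = \bigcap_i ((fun x : 'rV[R]_m => x ord0 i) @^-1` `[- t, t])); last first.
  apply/seteqP; split => x xcd i; first by move=> _; have := xcd i; rewrite !mxE.
  by rewrite !mxE; exact: xcd.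
apply: fin_bigcap_measurable => // i _; rewrite -[X in measurable X]setTI.
by apply: measurable_coor => //; exact: measurable_itv.
Qed.

Let lebesgue_box t : 0 <= t -> rV_lebesgue R m (box t) = ((2 * t) ^+ m)%:E.
Proof.
move=> t0; rewrite rV_lebesgue_box; last first.
  by move=> i; rewrite !mxE (le_trans _ t0)// oppr_le0.
congr EFin; under eq_bigr do rewrite !mxE opprK.
by rewrite big_const_ord iter_mulr_1 mulr_natl mulr2n.
Qed.

Lemma rV_lebesgue_eball_le (r : R) : 0 < r ->
  (rV_lebesgue R m (eball 0 r) <= ((2 * r) ^+ m)%:E)%E.
Proof.
move=> r0; rewrite -lebesgue_box ?(ltW r0)//; apply: (le_measure (rV_lebesgue R m)).
- by rewrite inE; exact: measurable_eball.
- by rewrite inE.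
rewrite eball_sqr// => x /=; rewrite subr0 enorm_sqr => xr i.
rewrite !mxE in_itv /= -ler_norml -(@ler_pXn2r _ 2)// ?nnegrE ?(ltW r0)//.
rewrite real_normK ?num_real// ltW//; apply: le_lt_trans xr.
by rewrite (bigD1 i)//= lerDl sumr_ge0// => j _; rewrite sqr_ge0.
Qed.

Lemma rV_lebesgue_eball_gt0 (r : R) : 0 < r ->
  (0 < rV_lebesgue R m (eball 0 r))%E.
Proof.
(* The cube of half-side [t] lies in the ball because [m * t ^+ 2 < r ^+ 2]; the denominator [m + 1]
   makes this strict and covers [m = 0]. *)
move=> r0; pose t := r / m.+1%:R.
have t0 : 0 < t by rewrite divr_gt0.
apply: (@lt_le_trans _ _ (rV_lebesgue R m (box t))).
  by rewrite lebesgue_box ?(ltW t0)// lte_fin exprn_gt0// mulr_gt0.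
apply: (le_measure (rV_lebesgue R m)); rewrite ?inE//; first exact: measurable_eball.
rewrite eball_sqr// => x /= xt; rewrite subr0 enorm_sqr.
apply: (@le_lt_trans _ _ (\sum_(i < m) t ^+ 2)).
  apply: ler_sum => i _; have := xt i; rewrite !mxE in_itv /= -ler_norml => xti.
  by rewrite -(real_normK (num_real _)) ler_pXn2r// nnegrE// ?(ltW t0).
rewrite sumr_const card_ord -mulr_natl /t exprMn exprVn mulrCA gtr_pMr ?exprn_gt0//.
rewrite ltr_pdivrMr ?exprn_gt0// mul1r -natrX ltr_nat.
by rewrite expnS mulSn ltn_addr// expn1.
Qed.

End euclidean_norm.

Section weight.
Context {R : realType}.
Variable m : nat.

Lemma weight_integrable (s : R) : m%:R < 2 * s ->
  (rV_lebesgue R m).-integrable setT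
    (EFin \o (fun x : 'rV[R]_m => (1 + enorm x ^+ 2) `^ (- s))).
Proof.
move=> ms.
have s0 : 0 <= s by rewrite -(@pmulr_rge0 _ 2)// (le_trans _ (ltW ms)).
(* Dyadic domination: the weight is at most [4^s 4^(-k s)] where
   [4^(k - 1) <= 1 + |x|^2 < 4^k]. *)
pose c k : R := 4 `^ s * (4 `^ (- s)) ^+ k.
have c0 k : 0 <= c k by rewrite mulr_ge0 ?exprn_ge0 ?powR_ge0.
pose f k (x : 'rV[R]_m) := ((c k)%:E * (\1_(eball 0 (2 ^+ k)) x)%:E)%E.
have mw : measurable_fun setT (fun x : 'rV[R]_m => (1 + enorm x ^+ 2) `^ (- s)).
  apply: (measurableT_comp (measurable_powR _)).
  apply: measurable_funD => //; exact: measurable_enorm_sqr.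
have mB k : measurable (eball (0 : 'rV[R]_m) (2 ^+ k : R)).
  by apply: measurable_eball; rewrite exprn_gt0.
have mf k : measurable_fun setT (f k).
  apply: emeasurable_funM => //; apply/measurable_EFinP; exact: measurable_indic.
have f0 k x : (0 <= f k x)%E by rewrite mule_ge0 ?lee_fin.
have wf x : (((1 + enorm x ^+ 2) `^ (- s))%:E <= \sum_(0 <= k <oo) f k x)%E.
  have ex : exists k, 1 + enorm x ^+ 2 < 4 ^+ k.
    have [k] : exists k, 1 + enorm x ^+ 2 < k%:R.
      by exists (Num.truncn (1 + enorm x ^+ 2)).+1; exact: truncnS_gt.
    move=> xk; exists k; apply: lt_le_trans xk _.
    by rewrite -natrX ler_nat ltnW// ltn_expl.
  (* [k = 0] is impossible because [1 + |x|^2 >= 1]. Otherwise minimality gives the lower bound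
     [4^k], and the single term of index [k + 1] already dominates the weight. *)
  case: (ex_minnP ex) => -[|k] xk kmin.
    by move: xk; rewrite expr0 gtrDl ltNge sqr_ge0.
  have kx : 4 ^+ k <= 1 + enorm x ^+ 2.
    by rewrite leNgt; apply/negP => /kmin; rewrite ltnn.
  apply: (@le_trans _ _ (f k.+1 x)); last first.
    rewrite (nneseriesD1 (n := k.+1))//.
    by rewrite leeDl// nneseries_ge0.
  rewrite /f indicE mem_set; last first.
    rewrite eball_sqr ?exprn_gt0//= subr0 -exprM mulnC exprM (_ : 2 ^+ 2 = 4 :> R).
      by rewrite (le_lt_trans _ xk)// lerDr.
    by rewrite expr2 -natrM.
  rewrite mule1 lee_fin /c [(4 `^ _) ^+ _]exprS mulrA -powRD; last by rewrite pnatr_eq0 implybT.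
  rewrite subrr powRr0 mul1r.
  have -> : (4 `^ (- s)) ^+ k = (4 ^+ k) `^ (- s).
    by rewrite -(powR_mulrn _ (powR_ge0 _ _)) -(powR_mulrn _ (ler0n _ 4)) -!powRrM mulrC.
  rewrite !powRN lef_pV2 ?posrE ?powR_gt0 ?exprn_gt0//; last first.
    by rewrite (lt_le_trans ltr01)// lerDl sqr_ge0.
  by apply: ge0_ler_powR; rewrite ?nnegrE// ?exprn_ge0// addr_ge0// sqr_ge0.
apply/integrableP; split; first exact/measurable_EFinP.
apply: (@le_lt_trans _ _ (\int[rV_lebesgue R m]_x \sum_(0 <= k <oo) f k x))%E.
  apply: ge0_le_integral => //=.
  - by apply/measurable_EFinP; exact: measurableT_comp.
  - by apply: ge0_emeasurable_sum.
  - by move=> x _; rewrite ger0_norm ?powR_ge0.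
rewrite integral_nneseries//.
(* Ratio of the dominating geometric series: from one ball to the next the height is multiplied by
   [4^-s] and the volume bound by [2^m]; [z < 1] amounts to [m < 2 s]. *)
pose z : R := 4 `^ (- s) * 2 ^+ m.
have z0 : 0 <= z by rewrite mulr_ge0 ?powR_ge0.
have z1 : z < 1.
  rewrite /z /powR pnatr_eq0/= (_ : 2 ^+ m = expR (m%:R * ln 2)); last first.
    by rewrite expRM_natl lnK// posrE.
  rewrite (_ : 4 = 2 ^+ 2); last by rewrite expr2 -natrM.
  rewrite lnXn// -expRD expR_lt1 -[ln 2 *+ 2]mulr_natl mulrA -mulrDl.
  by rewrite pmulr_llt0 ?ln_gt0 ?ltr1n// mulNr addrC subr_lt0 mulrC.
apply: (@le_lt_trans _ _ (4 `^ s * 2 ^+ m / (1 - z))%:E); last by rewrite ltry.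
apply: lime_le; first by apply: is_cvg_nneseries => k _ _; exact: integral_ge0.
apply: nearW => n.
have fk k : (\int[rV_lebesgue R m]_x f k x <= (4 `^ s * 2 ^+ m * z ^+ k)%:E)%E.
  rewrite /f ge0_integralZl//; last first.
  - by rewrite lee_fin.
  - by apply/measurable_EFinP; exact: measurable_indic.
  rewrite integral_indic// setIT.
  apply: (@le_trans _ _ ((c k)%:E * ((2 * 2 ^+ k) ^+ m)%:E)%E).
    by rewrite lee_wpmul2l ?lee_fin ?rV_lebesgue_eball_le ?exprn_gt0.
  rewrite -EFinM lee_fin /c /z !exprMn -[(2 ^+ k) ^+ m]exprM mulnC exprM.
  by rewrite le_eqVlt; apply/orP; left; apply/eqP; ring.
apply: (@le_trans _ _ (series (geometric (4 `^ s * 2 ^+ m) z) n)%:E).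
  by rewrite /series /= -sumEFin; apply: lee_sum => k _; exact: fk.
rewrite lee_fin geometric_seriesE ?lt_eqF//=.
rewrite ler_pM2r ?invr_gt0 ?subr_gt0// ler_piMr ?mulr_ge0 ?powR_ge0 ?exprn_ge0//.
by rewrite gerBl exprn_ge0.
Qed.

End weight.

(** * Dilated means *)

Section dilated_means.
Context {R : realType}.
Variable m : nat.
Notation mu := (rV_lebesgue R m).
Implicit Types (g : R -> R[i]) (h : 'rV[R]_m -> R[i]) (G : R -> R).
Implicit Types (y r c e : R).

Definition dilated_mean h (x0 : 'rV[R]_m) g (y : R) : R[i] :=
  (y ^- m)%:C *
  cintegral mu setT (fun x => g (enorm (x - x0) ^+ 2 / y ^+ 2) * h x).

(** Profiles take a squared distance as argument, so the weight becomes [(1 + |x|^2)^-s], integrable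
    on R^m when [m < 2 s]. *)
Definition profile (s : R) g : Prop :=
  cmeasurable_fun g /\
  exists C, forall r, 0 <= r -> Normc.normc (g r) <= C * (1 + r) `^ (- s).

Definition vanishing_mean h x0 g : Prop :=
  forall e : R, 0 < e ->
    \forall y \near +oo, Normc.normc (dilated_mean h x0 g y) < e.

Let affE (x0 x : 'rV[R]_m) y : 0 < y ->
  enorm (x - x0) ^+ 2 / y ^+ 2 = enorm (y^-1 *: x + - (y^-1 *: x0)) ^+ 2.
Proof. by move=> y0; rewrite -scalerBr enorm_sqrZ exprVn mulrC. Qed.

Lemma cmeasurable_dilated g (x0 : 'rV[R]_m) y : cmeasurable_fun g -> 0 < y ->
  cmeasurable_fun (fun x : 'rV[R]_m => g (enorm (x - x0) ^+ 2 / y ^+ 2)).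
Proof.
move=> mg y0; under eq_fun do rewrite affE//.
apply: (cmeasurableT_comp mg).
apply: (measurableT_comp (measurable_enorm_sqr (m := m))).
exact: measurable_affine.
Qed.

Section bounded_function.
Variables (h : 'rV[R]_m -> R[i]) (x0 : 'rV[R]_m) (M : R).
Hypothesis mh : cmeasurable_fun h.
Hypothesis hM : {ae mu, forall x, Normc.normc (h x) <= M}.

Let dilated_integrable G y : 0 < y ->
  mu.-integrable setT (EFin \o (fun x => G (enorm x ^+ 2))) ->
  mu.-integrable setT
    (EFin \o (fun x => G (enorm (x - x0) ^+ 2 / y ^+ 2) * M)).
Proof.
move=> y0 iG; rewrite /comp; under eq_fun do rewrite affE// mulrC EFinM.
apply: integrableZl => //.
by apply: (integrable_rV_affine (- (y^-1 *: x0)) _ iG); rewrite invr_gt0.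
Qed.

Let dilated_bound g G y : 0 < y ->
  (forall r, 0 <= r -> Normc.normc (g r) <= G r) ->
  {ae mu, forall x, Normc.normc (g (enorm (x - x0) ^+ 2 / y ^+ 2) * h x)
    <= G (enorm (x - x0) ^+ 2 / y ^+ 2) * M}.
Proof.
move=> y0 gG; apply: filterS hM => x hx; rewrite Normc.normcM.
apply: ler_pM => //; rewrite ?normc_ge0//.
by apply: gG; rewrite divr_ge0 ?sqr_ge0.
Qed.

Lemma dilated_cintegrable g G y : cmeasurable_fun g ->
  mu.-integrable setT (EFin \o (fun x => G (enorm x ^+ 2))) ->
  (forall r, 0 <= r -> Normc.normc (g r) <= G r) -> 0 < y ->
  cintegrable mu (fun x => g (enorm (x - x0) ^+ 2 / y ^+ 2) * h x).
Proof.
move=> mg iG gG y0; apply: (cintegrable_le _ (dilated_integrable y0 iG)).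
  by apply: cmeasurableM => //; exact: cmeasurable_dilated.
exact: dilated_bound.
Qed.

(** The Jacobian [y ^+ m] of the dilation cancels the prefactor [y ^- m]. The resulting bound is
    uniform in [y], which is what allows limits of profiles to be taken before [y] goes to
    infinity. *)
Lemma dilated_mean_le g G y : cmeasurable_fun g ->
  mu.-integrable setT (EFin \o (fun x => G (enorm x ^+ 2))) ->
  (forall r, 0 <= r -> Normc.normc (g r) <= G r) -> 0 < y ->
  Normc.normc (dilated_mean h x0 g y) <= 2 * M * \int[mu]_x G (enorm x ^+ 2).
Proof.
move=> mg iG gG y0.
have mgh : cmeasurable_fun
    (fun x : 'rV[R]_m => g (enorm (x - x0) ^+ 2 / y ^+ 2) * h x).
  by apply: cmeasurableM => //; exact: cmeasurable_dilated.
have := normc_cintegral_le mgh (dilated_integrable y0 iG) (dilated_bound y0 gG).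
rewrite /dilated_mean Normc.normcM normc_real ger0_norm ?invr_ge0 ?exprn_ge0 ?(ltW y0)//.
move=> le1; apply: le_trans (ler_wpM2l _ le1) _.
  by rewrite invr_ge0 exprn_ge0// ltW.
rewrite RintegralZr//; last first.
  rewrite /comp; under eq_fun do rewrite affE//.
  by apply: (integrable_rV_affine (- (y^-1 *: x0)) _ iG); rewrite invr_gt0.
under eq_Rintegral do rewrite affE//.
rewrite (@Rintegral_rV_affine _ _ _ _ (fun x => G (enorm x ^+ 2))) ?invr_gt0//.
rewrite exprVn invrK.
set I := \int[_]_x _.
rewrite (_ : y ^- m * _ = y ^- m * y ^+ m * (2 * M * I)); last by ring.
by rewrite mulVf ?mul1r// expf_neq0// gt_eqF.
Qed.

Variable s : R.
Hypothesis ms : m%:R < 2 * s.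

Let profile_integrable C :
  mu.-integrable setT (EFin \o (fun x => C * (1 + enorm x ^+ 2) `^ (- s))).
Proof.
rewrite /comp; under eq_fun do rewrite EFinM.
by apply: integrableZl => //; exact: weight_integrable.
Qed.

Lemma profile_cintegrable g y : profile s g -> 0 < y ->
  cintegrable mu (fun x => g (enorm (x - x0) ^+ 2 / y ^+ 2) * h x).
Proof.
move=> [mg [C gC]] y0.
exact: (dilated_cintegrable mg (profile_integrable C) gC).
Qed.

Lemma dilated_meanD (c1 c2 : R[i]) g1 g2 y : 0 < y ->
  profile s g1 -> profile s g2 ->
  dilated_mean h x0 (fun r => c1 * g1 r + c2 * g2 r) y =
  c1 * dilated_mean h x0 g1 y + c2 * dilated_mean h x0 g2 y.
Proof.
move=> y0 p1 p2; have i1 := profile_cintegrable p1 y0.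
have i2 := profile_cintegrable p2 y0.
rewrite /dilated_mean [c1 * _]mulrCA [c2 * _]mulrCA -mulrDr; congr (_ * _).
rewrite -!cintegralZ// -cintegralD; [|exact: cintegrableZ|exact: cintegrableZ].
by congr (cintegral mu setT _); apply/funext => x; rewrite mulrDl !mulrA.
Qed.

(** As profiles see squared distances, multiplying the argument by [c] divides [y] by the square
    root of [c]. *)
Lemma dilated_mean_dilation g c y : 0 < c -> 0 < y ->
  dilated_mean h x0 (fun r => g (c * r)) y =
  (Num.sqrt c ^- m)%:C * dilated_mean h x0 g (y / Num.sqrt c).
Proof.
move=> c0 y0; have sc0 : 0 < Num.sqrt c by rewrite sqrtr_gt0.
rewrite /dilated_mean mulrA -rmorphM/=; congr (_%:C * _).
  by rewrite exprMn exprVn invfM invrK mulrCA mulVf ?mulr1// expf_neq0// gt_eqF.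
congr (cintegral mu setT _); apply/funext => x; congr (g _ * _).
set q := enorm _ ^+ 2.
by rewrite expr_div_n sqr_sqrtr ?(ltW c0)// invf_div mulrCA.
Qed.

Lemma vanishing_meanD (c1 c2 : R[i]) g1 g2 :
  profile s g1 -> profile s g2 ->
  vanishing_mean h x0 g1 -> vanishing_mean h x0 g2 ->
  vanishing_mean h x0 (fun r => c1 * g1 r + c2 * g2 r).
Proof.
move=> p1 p2 v1 v2 e e0.
pose A := Normc.normc c1 + Normc.normc c2 + 1.
have A0 : 0 < A by rewrite ltr_wpDl ?addr_ge0 ?normc_ge0.
have eA : 0 < e / A by rewrite divr_gt0.
near=> y.
have y0 : 0 < y by near: y; exact: nbhs_pinfty_gt.
rewrite dilated_meanD//; apply: le_lt_trans (normc_triangle _ _) _.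
rewrite (Normc.normcM c1) (Normc.normcM c2).
have n1 : Normc.normc (dilated_mean h x0 g1 y) < e / A by near: y; exact: v1.
have n2 : Normc.normc (dilated_mean h x0 g2 y) < e / A by near: y; exact: v2.
apply: (@le_lt_trans _ _ ((Normc.normc c1 + Normc.normc c2) * (e / A))).
  by rewrite mulrDl; apply: lerD; apply: ler_wpM2l; rewrite ?normc_ge0 ?(ltW n1) ?(ltW n2).
by rewrite mulrA ltr_pdivrMr// mulrC ltr_pM2l// /A ltrDl.
Unshelve. all: by end_near. Qed.

Lemma vanishing_mean_dilation g c : 0 < c -> vanishing_mean h x0 g ->
  vanishing_mean h x0 (fun r => g (c * r)).
Proof.
move=> c0 v e e0; have sc0 : 0 < Num.sqrt c by rewrite sqrtr_gt0.
have [Y [_ vY]] := v _ (mulr_gt0 e0 (exprn_gt0 m sc0)).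
near=> y.
have y0 : 0 < y by near: y; exact: nbhs_pinfty_gt.
rewrite dilated_mean_dilation// Normc.normcM normc_real ger0_norm; last first.
  by rewrite invr_ge0 exprn_ge0// ltW.
rewrite mulrC ltr_pdivrMr ?exprn_gt0//; apply: vY.
by rewrite ltr_pdivlMr//; near: y; apply: nbhs_pinfty_gt; rewrite num_real.
Unshelve. all: by end_near. Qed.

Lemma profile_limit (gN : nat -> R -> R[i]) g C :
  (forall N r, 0 <= r -> Normc.normc (gN N r) <= C * (1 + r) `^ (- s)) ->
  (forall r, 0 <= r -> Normc.normc (gN N r - g r) @[N --> \oo] --> (0 : R)) ->
  forall r, 0 <= r -> Normc.normc (g r) <= C * (1 + r) `^ (- s).
Proof.
move=> gNC gNg r r0; apply/ler_addgt0Pr => e e0.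
have /cvgrPdist_lt/(_ _ e0)[N _ /(_ _ (leqnn N))] := gNg _ r0.
rewrite sub0r normrN ger0_norm ?normc_ge0// => Ne.
rewrite (_ : g r = gN N r - (gN N r - g r)); last by rewrite opprB addrCA subrr addr0.
apply: le_trans (normc_triangle _ _) _.
by rewrite normc_opp lerD ?gNC// ltW.
Qed.

(** Dominated convergence makes the integral of [|gN N - g|] at [|x|^2] small for some fixed [N].
    The bound uniform in [y] then keeps the two means close for every [y > 0], and the mean of
    [gN N] tends to 0. *)
Lemma vanishing_mean_limit (gN : nat -> R -> R[i]) g C : cmeasurable_fun g ->
  (forall N, cmeasurable_fun (gN N)) ->
  (forall N r, 0 <= r -> Normc.normc (gN N r) <= C * (1 + r) `^ (- s)) ->
  (forall r, 0 <= r -> Normc.normc (gN N r - g r) @[N --> \oo] --> (0 : R)) ->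
  (forall N, vanishing_mean h x0 (gN N)) -> vanishing_mean h x0 g.
Proof.
move=> mg mgN gNC gNg vN e e0.
have gC := profile_limit gNC gNg.
pose D N r := Normc.normc (gN N r - g r).
have mDg N : cmeasurable_fun (fun r => gN N r + (-1) * g r).
  by apply: cmeasurableD => //; apply: cmeasurableM => //; exact: cmeasurable_cst.
have mD N : measurable_fun setT (fun x : 'rV[R]_m => D N (enorm x ^+ 2)).
  apply: (measurableT_comp _ (measurable_enorm_sqr (m := m))).
  rewrite /D (_ : (fun r => _) = (fun r => Normc.normc (gN N r + (-1) * g r))).
    exact: measurable_normc.
  by apply/funext => r; rewrite mulN1r.
have DC N r : 0 <= r -> D N r <= (2 * C) * (1 + r) `^ (- s).
  move=> r0; apply: le_trans (normc_triangle _ _) _.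
  by rewrite normc_opp mulr_natl mulr2n mulrDl lerD ?gNC ?gC.
have mD' N : measurable_fun setT (EFin \o (fun x : 'rV[R]_m => D N (enorm x ^+ 2))).
  exact/measurable_EFinP.
have DC' N (x : 'rV[R]_m) : (`|(D N (enorm x ^+ 2))%:E| <=
    (2 * C * (1 + enorm x ^+ 2) `^ (- s))%:E)%E.
  by rewrite lee_fin ger0_norm ?normc_ge0// DC// sqr_ge0.
have iD N : mu.-integrable setT (EFin \o (fun x => D N (enorm x ^+ 2))).
  apply: (le_integrable measurableT (mD' N) _ (profile_integrable (2 * C))).
  move=> x _; apply: le_trans (DC' N x) _.
  by rewrite lee_fin ler_norm.
have cvI : \int[mu]_x D N (enorm x ^+ 2) @[N --> \oo] --> (0 : R).
  have [] := @dominated_convergence _ _ _ mu _ measurableT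
    (fun N x => (D N (enorm x ^+ 2))%:E) (cst 0%E) _ mD' (measurable_cst _) _
    (profile_integrable (2 * C)) _.
  - apply: aeW => x _; apply: cvg_EFin; first exact: nearW.
    by apply: gNg; exact: sqr_ge0.
  - by apply: aeW => x N _; exact: DC'.
  by move=> _ _; rewrite integral0 => /fine_cvg.
have e2 : 0 < e / 2 by rewrite divr_gt0.
have : 2 * M * \int[mu]_x D N (enorm x ^+ 2) @[N --> \oo] --> (2 * M * 0 : R).
  exact: cvgMr.
rewrite mulr0 => /cvgrPdist_lt/(_ _ e2)[N _ /(_ _ (leqnn N))].
rewrite sub0r normrN => /(le_lt_trans (ler_norm _)) IN.
near=> y.
have y0 : 0 < y by near: y; exact: nbhs_pinfty_gt.
have vy : Normc.normc (dilated_mean h x0 (gN N) y) < e / 2.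
  by near: y; exact: vN.
have pN : profile s (gN N) by split=> //; exists C; exact: gNC.
have pg : profile s g by split=> //; exists C; exact: gC.
have -> : dilated_mean h x0 g y = dilated_mean h x0 (gN N) y -
    dilated_mean h x0 (fun r => 1 * gN N r + (-1) * g r) y.
  by rewrite dilated_meanD// mul1r mulN1r opprB addrCA subrr addr0.
apply: le_lt_trans (normc_triangle _ _) _.
rewrite normc_opp [e]splitr ltrD//.
apply: le_lt_trans _ IN; apply: dilated_mean_le => //.
  by under eq_fun do rewrite mul1r.
by move=> r r0; rewrite mul1r mulN1r.
Unshelve. all: by end_near. Qed.

End bounded_function.
End dilated_means.

(** * Classes of profiles *)

Section function_classes.
Context {R : realType}.
Implicit Types (g : R -> R[i]) (W : R -> R) (Q : (R -> R[i]) -> Prop).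

Definition linear_class Q : Prop := forall (c1 c2 : R[i]) g1 g2,
  Q g1 -> Q g2 -> Q (fun r => c1 * g1 r + c2 * g2 r).

(** The weight is a parameter because closure is used both for [(1 + r)^-sigma] and, once this
    factor is divided out, for constants. Bounds and limits are tested only at [r >= 0], where
    squared norms lie. *)
Definition limit_closed W Q : Prop := forall (gN : nat -> R -> R[i]) g (C : R),
  cmeasurable_fun g -> (forall N, Q (gN N)) ->
  (forall N r, 0 <= r -> Normc.normc (gN N r) <= C * W r) ->
  (forall r, 0 <= r -> Normc.normc (gN N r - g r) @[N --> \oo] --> (0 : R)) ->
  Q g.

(** A constant sequence converges, in the sense of [limit_closed], to any function that agrees with
    it on [r >= 0]; values at negative [r] are thus immaterial. *)
Lemma limit_closed_ext W Q g1 g2 (C : R) : limit_closed W Q ->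
  cmeasurable_fun g2 -> (forall r, 0 <= r -> Normc.normc (g1 r) <= C * W r) ->
  (forall r, 0 <= r -> g1 r = g2 r) -> Q g1 -> Q g2.
Proof.
move=> Qlim mg2 g1W g12 Qg1; apply: (Qlim (fun=> g1) _ C) => //.
by move=> r r0; rewrite g12// subrr Normc.normc0; exact: cvg_cst.
Qed.

Lemma linear_class_sum Q n (c : nat -> R[i]) (g : nat -> R -> R[i]) :
  linear_class Q -> (forall k, Q (g k)) ->
  Q (fun r => \sum_(k < n) c k * g k r).
Proof.
move=> Qlin Qg; elim: n => [|n IH].
  rewrite (_ : (fun r => _) = (fun r => 0 * g 0%N r + 0 * g 0%N r)).
    exact: Qlin.
  by apply/funext => r; rewrite big_ord0 !mul0r addr0.
rewrite (_ : (fun r => _) =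
  (fun r => 1 * (\sum_(k < n) c k * g k r) + c n * g n r)).
  exact: Qlin.
by apply/funext => r; rewrite big_ord_recr mul1r.
Qed.

Definition step (t r : R) : R[i] := if r < t then 1 else 0.

Lemma cmeasurable_step (t : R) : cmeasurable_fun (step t).
Proof.
split; last first.
  by rewrite (_ : (fun x => _) = cst 0)//; apply/funext => r; rewrite /step; case: ifP.
rewrite (_ : (fun x => _) = \1_(`]-oo, t[)); first exact: measurable_indic.
by apply/funext => r; rewrite indicE mem_setE in_itv /step /=; case: ifP.
Qed.

(** * Approximation of right-continuous functions by staircases *)

Section step_approximation.
Variables (Q : (R -> R[i]) -> Prop) (W : R -> R) (G : R -> R[i]).
Hypothesis Qlin : linear_class Q.
Hypothesis Qlim : limit_closed W Q.
Hypothesis Qstep : forall t : R, 0 < t -> Q (step t).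
Hypothesis mG : cmeasurable_fun G.
Hypothesis W0 : forall r : R, 0 <= r -> 0 <= W r.
Hypothesis GW : forall r r' : R, 0 <= r -> r <= r' -> Normc.normc (G r') <= W r.
Hypothesis G_right : forall r e : R, 0 <= r -> 0 < e ->
  exists2 d : R, 0 < d & forall r', r < r' < r + d -> Normc.normc (G r' - G r) < e.

(** The first cell of a staircase starts at 0, a threshold that [Qstep] excludes; on [r >= 0],
    [step 0] agrees with a combination whose coefficients are 0. *)
Let step0 (t : R) : 0 <= t -> Q (step t).
Proof.
rewrite le_eqVlt => /orP[/eqP <-|]; last exact: Qstep.
have Q1 := Qstep ltr01.
have := Qlin 0 0 Q1 Q1; apply: (limit_closed_ext (C := 1) Qlim).
- exact: cmeasurable_step.
- by move=> r r0; rewrite !mul0r addr0 Normc.normc0 mul1r W0.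
- by move=> r r0; rewrite !mul0r addr0 /step ltNge r0.
Qed.

Let stair (N J : nat) (r : R) : R[i] :=
  \sum_(k < J) G (k.+1%:R / N.+1%:R) *
    (1 * step (k.+1%:R / N.+1%:R) r + (-1) * step (k%:R / N.+1%:R) r).

Let Q_stair N J : Q (stair N J).
Proof.
apply: (linear_class_sum J (fun k => G (k.+1%:R / N.+1%:R))
  (g := fun k r => 1 * step (k.+1%:R / N.+1%:R) r + (-1) * step (k%:R / N.+1%:R) r)) => //.
by move=> k; apply: Qlin; apply: step0; rewrite divr_ge0.
Qed.

(** Differences of consecutive steps are indicators of cells of length [1 / (N + 1)], so only the
    cell containing [r] contributes; the integer part of [r * (N + 1)] is its index. *)
Let stairE N J r : 0 <= r -> stair N J r =
  if r < J%:R / N.+1%:R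
  then G ((Num.truncn (r * N.+1%:R)).+1%:R / N.+1%:R) else 0.
Proof.
move=> r0; rewrite /stair; elim: J => [|J IH].
  by rewrite big_ord0 mul0r ltNge r0.
rewrite big_ord_recr /= IH mul1r mulN1r /step.
case: ifPn => [rJ|].
  have -> : r < J.+1%:R / N.+1%:R.
    by apply: lt_trans rJ _; rewrite ltr_pM2r ?invr_gt0// ltr_nat.
  by rewrite subrr mulr0 addr0.
rewrite -leNgt => Jr; rewrite subr0 add0r.
case: ifPn => rJ; last by rewrite mulr0.
rewrite mulr1; congr (G (_.+1%:R / _)); apply/esym/eqP.
rewrite truncn_eq ?mulr_ge0//.
by rewrite -ler_pdivrMr// Jr /= -ltr_pdivlMr.
Qed.

(** Sampling at right endpoints serves both needs: [GW] bounds the staircase at [r] by [W r], and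
    [G_right] gives pointwise convergence. *)
Lemma step_approximation : Q G.
Proof.
(* With [(N + 1)^2] cells of length [1 / (N + 1)] the staircase covers [[0, N + 1)], hence
   eventually every [r]. *)
apply: (Qlim (gN := fun N => stair N (N.+1 ^ 2)%N) (C := 1)) => //.
  move=> N r r0; rewrite stairE// mul1r; case: ifPn => _; last first.
    by rewrite Normc.normc0 W0.
  apply: GW => //; rewrite ler_pdivlMr//.
  by rewrite ltW// truncnS_gt.
move=> r r0; apply/cvgrPdist_lt => e e0.
have [d d0 rd] := G_right r0 e0.
near=> N; rewrite sub0r normrN ger0_norm ?normc_ge0//.
rewrite stairE// ifT.
  apply: rd; rewrite ltr_pdivlMr// truncnS_gt/=.
  rewrite ltr_pdivrMr// mulrDl -natr1; apply: ler_ltD.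
    by rewrite truncn_le// mulr_ge0.
  rewrite mulrC -ltr_pdivrMl// mulr1.
  near: N; exact: near_infty_natSinv_lt (PosNum d0).
rewrite expnS expn1 natrM mulfK ?pnatr_eq0//.
near: N; exists (Num.truncn r).+1 => // N /= rN.
apply: lt_le_trans (truncnS_gt r) _; rewrite ler_nat; exact: leqW.
Unshelve. all: by end_near. Qed.

End step_approximation.
End function_classes.

(** * Power profiles *)

Section power_profiles.
Context {R : realType}.
Implicit Types (p z : R[i]) (r v e : R).

Lemma is_derive_right_quotient (f : R -> R) (a e : R) :
  is_derive (0 : R) 1 f a -> 0 < e ->
  exists2 d : R, 0 < d &
    forall v, 0 < v < d -> `|f v - f 0 - a * v| <= e * v.
Proof.
move=> [df fa] e0; move: df => /cvg_ex[l fl].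
have la : l = a by rewrite -fa; apply/esym/cvg_lim.
rewrite la in fl; move/cvgrPdist_le : fl => /(_ _ e0)[d /= d0 fd].
exists d => // v /andP[v0 vd].
have := fd v; rewrite /= sub0r normrN gtr0_norm// => /(_ vd).
rewrite gt_eqF// => /(_ isT); rewrite addr0 /GRing.scale /= mulr1.
move=> H; rewrite (_ : _ - _ = (v^-1 * (f v - f 0) - a) * v); last first.
  by rewrite mulrBl mulrAC mulVf ?gt_eqF// mul1r.
by rewrite normrM (gtr0_norm v0) ler_pM2r// distrC.
Qed.

(** For [z = a + i b] the real and imaginary parts are [expR (a * ln (1 + v))] times the cosine and
    sine of [b * ln (1 + v)]. Their derivatives at 0 are [a] and [b], and each part receives half of
    [e]. *)
Lemma cpow_first_order z e : 0 < e -> exists2 d : R, 0 < d &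
  forall v, 0 < v < d -> Normc.normc (cpow (1 + v) z - 1 - z * v%:C) <= e * v.
Proof.
move=> e0; case: z => a b; have e2 : 0 < e / 2 by rewrite divr_gt0.
have dl (c : R) : is_derive (0 : R) 1 (fun v : R => c * ln (1 + v)) c.
  have d1 : is_derive (0 : R) 1 (fun v : R => ln (1 + v)) 1.
    have d0 : is_derive (0 : R) 1 (fun v : R => 1 + v) 1.
      have := is_deriveD (is_derive_cst (1 : R) (0 : R) (1 : R)) (is_derive_id (0 : R) (1 : R)).
      by rewrite add0r.
    have dln : is_derive (1 + 0 : R) 1 (@ln R) 1.
      by apply: is_derive_eq; [apply: is_derive1_ln; rewrite addr0|rewrite addr0 invr1].
    by have := is_derive1_comp dln d0; rewrite mulr1.
  by have := is_deriveZ c d1; rewrite /GRing.scale /= mulr1.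
have dexp : is_derive (0 : R) 1 (fun v : R => expR (a * ln (1 + v))) a.
  have := @is_derive1_comp R expR (fun v => a * ln (1 + v)) 0 _ _
    (is_derive_expR _) (dl a).
  by rewrite addr0 ln1 mulr0 expR0 mul1r.
have dcos : is_derive (0 : R) 1 (fun v : R => cos (b * ln (1 + v))) 0.
  have := @is_derive1_comp R cos (fun v => b * ln (1 + v)) 0 _ _
    (is_derive_cos _) (dl b).
  by rewrite addr0 ln1 mulr0 sin0 oppr0 mul0r.
have dsin : is_derive (0 : R) 1 (fun v : R => sin (b * ln (1 + v))) b.
  have := @is_derive1_comp R sin (fun v => b * ln (1 + v)) 0 _ _
    (is_derive_sin _) (dl b).
  by rewrite addr0 ln1 mulr0 cos0 mul1r.
have dre := is_deriveM dexp dcos; have dim := is_deriveM dexp dsin.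
rewrite /= addr0 ln1 !mulr0 expR0 cos0 scaler0 add0r scale1r in dre.
rewrite /= addr0 ln1 !mulr0 expR0 sin0 scale0r addr0 scale1r in dim.
have [d1 d10 Hre] := is_derive_right_quotient dre e2.
have [d2 d20 Him] := is_derive_right_quotient dim e2.
exists (Num.min d1 d2); first by rewrite lt_min d10.
move=> v /andP[v0]; rewrite lt_min => /andP[vd1 vd2].
apply: le_trans (normc_le_ReIm _) _.
rewrite [e]splitr mulrDl lerD//.
  have := Hre v; rewrite v0 vd1 => /(_ isT).
  rewrite !fctE addr0 ln1 !mulr0 expR0 cos0 mulr1 /=.
  by rewrite !(mulr0, subr0, addr0, mul0r, add0r, oppr0).
have := Him v; rewrite v0 vd2 => /(_ isT).
rewrite !fctE addr0 ln1 !mulr0 sin0 mulr0 /=.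
by rewrite !(mulr0, subr0, addr0, mul0r, add0r, oppr0).
Qed.

Definition power_profile p r : R[i] := cpow (1 + r) (- p).

Lemma cmeasurable_cpow1D z : cmeasurable_fun (fun r : R => cpow (1 + r) z).
Proof.
case: z => a b.
have ml c : measurable_fun setT (fun r : R => c * ln (1 + r)).
  apply: measurable_funM => //; apply: (measurableT_comp (@measurable_ln R)).
  exact: measurable_funD.
have mc (f : R -> R) : continuous f -> measurable_fun setT (fun r => f (b * ln (1 + r))).
  by move=> cf; apply: (measurableT_comp (continuous_measurable_fun cf)).
have me : measurable_fun setT (fun r => expR (a * ln (1 + r))).
  exact: (measurableT_comp (@measurable_expR R)).
have E (r : R) : (a +i* b) * (ln (1 + r))%:C = (a * ln (1 + r)) +i* (b * ln (1 + r)).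
  by apply: complex_eq; rewrite /= !(mulr0, subr0, add0r).
split; rewrite /cpow /cexp; under eq_fun do rewrite E /=.
  by apply: measurable_funM => //; apply: mc; exact: continuous_cos.
by apply: measurable_funM => //; apply: mc; exact: continuous_sin.
Qed.

Lemma normc_power_profile p r : 0 <= r ->
  Normc.normc (power_profile p r) = (1 + r) `^ (- complex.Re p).
Proof.
move=> r0; rewrite normc_cpow; first by case: p.
by rewrite (lt_le_trans ltr01)// lerDl.
Qed.

(** This turns the exponents [s + k] into monomials in [1 / (1 + r)]. *)
Lemma power_profileS p r : 0 <= r ->
  power_profile (p + 1) r = power_profile p r * ((1 + r)^-1)%:C.
Proof.
move=> r0; have r1 : 0 < 1 + r by rewrite (lt_le_trans ltr01)// lerDl.
rewrite /power_profile opprD cpowD; congr (_ * _).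
have E : cpow (1 + r) 1 = (1 + r)%:C := cpow_nat 1 r1.
by rewrite cpowN E fmorphV.
Qed.

End power_profiles.

(** * The Tauberian argument *)

Section tauberian.
Context {R : realType}.
Implicit Types (r t e : R).

Lemma bernoulli_ge (x : R) n : 0 <= x -> 1 + n%:R * x <= (1 + x) ^+ n.
Proof.
move=> x0; elim: n => [|n IH]; first by rewrite expr0 mul0r addr0.
have x1 : 0 <= 1 + x by rewrite addr_ge0.
rewrite exprS; apply: le_trans (ler_wpM2l x1 IH).
rewrite -subr_ge0 -natr1 (_ : _ - _ = n%:R * x ^+ 2); last by ring.
by rewrite mulr_ge0 ?sqr_ge0.
Qed.

Lemma bernoulli_le (x : R) n : 0 <= x <= 1 -> 1 - n%:R * x <= (1 - x) ^+ n.
Proof.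
move=> /andP[x0 x1]; elim: n => [|n IH]; first by rewrite expr0 mul0r subr0.
have x1' : 0 <= 1 - x by rewrite subr_ge0.
rewrite exprS; apply: le_trans (ler_wpM2l x1' IH).
rewrite -subr_ge0 -natr1 (_ : _ - _ = n%:R * x ^+ 2); last by ring.
by rewrite mulr_ge0 ?sqr_ge0.
Qed.

(** Multiply by [(1 + x) ^+ n], which is at least [n * x]: the product [(1 - x^2)^n] is at most
    1. *)
Lemma onem_expr_le (x : R) n : 0 < x <= 1 -> (0 < n)%N ->
  (1 - x) ^+ n <= (n%:R * x)^-1.
Proof.
move=> /andP[x0 x1] n0; have nx : 0 < n%:R * x by rewrite mulr_gt0// ltr0n.
rewrite -[leRHS]mul1r ler_pdivlMr//.
apply: (@le_trans _ _ ((1 - x) ^+ n * (1 + x) ^+ n)).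
  rewrite ler_wpM2l ?exprn_ge0 ?subr_ge0//.
  by apply: le_trans (bernoulli_ge _ (ltW x0)); rewrite lerDr.
by rewrite -exprMn exprn_ile1// -subr_sqr ?expr1n ?subr_ge0 ?gerBl ?sqr_ge0 ?expr_le1 ?(ltW x0).
Qed.

(* For [M = threshold_exponent t n], the product [M x^n] tends to [0] if
   [x <= 1 / (1 + t)] and to infinity if [x > 1 / (1 + t)], so that
   [1 - (1 - x^n)^M] tends to the indicator of [x > 1 / (1 + t)]. *)
Definition threshold_exponent (t : R) (n : nat) : nat :=
  (Num.truncn ((1 + t) ^+ n / n%:R)).+1.

Lemma threshold_limit t r : 0 < t -> 0 <= r ->
  exists D : R, forall n, (0 < n)%N ->
  `| 1 - (1 - (1 + r)^-1 ^+ n) ^+ threshold_exponent t n - (if r < t then 1 else 0) |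
    <= D / n%:R.
Proof.
move=> t0 r0; have t1 : 0 < 1 + t by rewrite addr_gt0.
have r1 : 0 < 1 + r by rewrite ltr_wpDr.
pose x := (1 + r)^-1; have x0 : 0 < x by rewrite invr_gt0.
have x1 : x <= 1 by rewrite invf_le1// lerDl.
have xn n : 0 <= 1 - x ^+ n by rewrite subr_ge0 exprn_ile1// ltW.
case: ifPn => rt.
  (* Bernoulli is applied to the square root [q], so that [((1 + t) * x) ^+ n] dominates
     [n^2 (q - 1)^2] and still grows after the division by [n] in [threshold_exponent]. *)
  pose q := Num.sqrt ((1 + t) * x).
  have q1 : 1 < q.
    by rewrite -sqrtr1 ltr_sqrt// ?mulr_gt0// ltr_pdivlMr// mul1r ltrD2l.
  exists ((q - 1) ^- 2) => n n0; have n0' : 0 < n%:R :> R by rewrite ltr0n.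
  rewrite addrAC subrr add0r normrN ger0_norm ?exprn_ge0//.
  apply: le_trans (onem_expr_le _ _) _; rewrite ?exprn_gt0// ?exprn_ile1 ?(ltW x0)//.
  have qn : (n%:R * (q - 1)) ^+ 2 <= ((1 + t) * x) ^+ n.
    have -> : ((1 + t) * x) ^+ n = (q ^+ n) ^+ 2.
      by rewrite -exprM mulnC exprM sqr_sqrtr// mulr_ge0 ?(ltW t1) ?(ltW x0).
    have nq : n%:R * (q - 1) <= q ^+ n.
      have q0 : 0 <= q - 1 by rewrite subr_ge0 ltW.
      rewrite -[in leRHS](subrK 1 q) [in leRHS]addrC.
      by apply: le_trans (bernoulli_ge _ q0); rewrite lerDr.
    by rewrite !expr2 ler_pM// mulr_ge0// subr_ge0 ltW.
  have q10 : 0 < q - 1 by rewrite subr_gt0.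
  rewrite -invfM lef_pV2 ?posrE ?mulr_gt0 ?exprn_gt0 ?ltr0n//.
  apply: (@le_trans _ _ ((1 + t) ^+ n / n%:R * x ^+ n)); last first.
    by rewrite ler_pM2r ?exprn_gt0// ltW// truncnS_gt.
  rewrite [leRHS]mulrAC -exprMn ler_pdivlMr//; apply: le_trans qn.
  by rewrite le_eqVlt; apply/orP; left; apply/eqP; ring.
have {rt}tr : t <= r by rewrite leNgt.
(* Here [threshold_exponent t n] times [x^n] is at most [1 / n], from the main part, plus
   [(1 + t)^-n <= 1 / (n t)], from the rounding. *)
exists (1 + t^-1) => n n0; have n0' : 0 < n%:R :> R by rewrite ltr0n.
rewrite subr0 ger0_norm; last first.
  by rewrite subr_ge0 exprn_ile1// gerBl exprn_ge0// ltW.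
pose a := (1 + t)^-1 ^+ n.
have xa : x ^+ n <= a.
  apply: lerXn2r; rewrite ?nnegrE ?invr_ge0 ?(ltW x0) ?(ltW t1) ?(ltW r1)//.
  by rewrite /x lef_pV2 ?posrE// lerD2l.
have an : a <= (n%:R * t)^-1.
  rewrite /a exprVn lef_pV2 ?posrE ?exprn_gt0 ?mulr_gt0//.
  by apply: le_trans (bernoulli_ge _ (ltW t0)); rewrite lerDr.
apply: (@le_trans _ _ ((threshold_exponent t n)%:R * x ^+ n)).
  rewrite lerBlDr addrC -lerBlDr; apply: bernoulli_le.
  by rewrite exprn_ge0 ?exprn_ile1 ?(ltW x0).
apply: (@le_trans _ _ (((1 + t) ^+ n / n%:R + 1) * a)).
  rewrite ler_pM ?exprn_ge0 ?(ltW x0)// -natr1 lerD2r truncn_le//.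
  by rewrite divr_ge0 ?exprn_ge0 ?(ltW t1).
rewrite mulrDl mul1r mulrAC /a exprVn mulfV ?gt_eqF ?exprn_gt0// mulrDl mul1r.
by rewrite lerD2l -exprVn (le_trans an)// invfM mulrC.
Qed.

End tauberian.

(** * From the power profile to the unit step and back, in an abstract stable class *)

Section tauberian_class.
Context {R : realType}.
Variables (s : R[i]) (K : (R -> R[i]) -> Prop).
Hypothesis s0 : 0 < complex.Re s.
Hypothesis Klin : linear_class K.
Hypothesis Klim : limit_closed (fun r => (1 + r) `^ (- complex.Re s)) K.
Hypothesis Kdil : forall g (c : R), 0 < c -> K g -> K (fun r => g (c * r)).

Let W (r : R) : R := (1 + r) `^ (- complex.Re s).

Let W_decr (r r' a : R) : complex.Re s <= a -> 0 <= r -> r <= r' ->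
  (1 + r') `^ (- a) <= W r.
Proof.
move=> sa r0 rr'; have r1 : 1 <= 1 + r by rewrite lerDl.
have r'1 : 1 <= 1 + r' by rewrite lerDl (le_trans r0).
apply: (@le_trans _ _ ((1 + r') `^ (- complex.Re s))).
  by apply: ler_powR; rewrite ?lerN2.
rewrite /W !powRN lef_pV2 ?posrE ?powR_gt0 ?(lt_le_trans ltr01)//.
apply: ge0_ler_powR; rewrite ?nnegrE ?(ltW s0) ?(le_trans ler01)//.
by rewrite lerD2l.
Qed.

(* [power_profile (p + 1)] is, up to the factor [p], the derivative of the
   dilates of [power_profile p]. *)
Lemma power_profile_raise p : complex.Re s <= complex.Re p ->
  K (power_profile p) -> K (power_profile (p + 1)).
Proof.
move=> sp Kp.
have p0 : p != 0.
  by apply/eqP => p0; move: (lt_le_trans s0 sp); rewrite p0 ltxx.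
have np0 : 0 < Normc.normc p.
  by rewrite lt_neqAle normc_ge0 eq_sym andbT; apply: contra p0 => /eqP/Normc.eq0_normc ->.
(* Error constant 1 serves the domination of the quotients; the constant [e * |p|] will serve their
   convergence. *)
have [d d0 dE] := cpow_first_order (- p) (ltr01 : 0 < 1 :> R).
(* The [+2] gives [h N < d] already at [N = 0], so domination holds for every [N]. *)
pose h (N : nat) : R := d / N.+2%:R.
have h0 N : 0 < h N by rewrite divr_gt0.
(* Since [(1 + h) (1 + r / (1 + h)) = 1 + h + r], this is the quotient
   [((1 + r)^-p - (1 + h + r)^-p) / (p h)]: a dilation times a constant produces the shift of [r] by
   [h]. *)
pose gN (N : nat) (r : R) : R[i] :=
  (- cpow (1 + h N) (- p) / (p * (h N)%:C)) * power_profile p ((1 + h N)^-1 * r) +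
  (p * (h N)%:C)^-1 * power_profile p r.
pose E N r : R[i] := cpow (1 + h N / (1 + r)) (- p) - 1 - (- p) * (h N / (1 + r))%:C.
have r1 (r : R) : 0 <= r -> 0 < 1 + r by move=> r0; rewrite ltr_pwDl.
have hC N : (h N)%:C != 0 :> R[i].
  by rewrite eq_complex /= eqxx andbT gt_eqF.
have gNE N r : 0 <= r -> gN N r =
    power_profile p r * (((1 + r)^-1)%:C - E N r / (p * (h N)%:C)).
  move=> r0; have rC : (1 + r)%:C != 0 :> R[i].
    by rewrite eq_complex /= eqxx andbT gt_eqF// r1.
  have -> : gN N r = power_profile p r *
      ((1 - cpow (1 + h N / (1 + r)) (- p)) / (p * (h N)%:C)).
    have dil : cpow (1 + h N) (- p) * power_profile p ((1 + h N)^-1 * r) =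
        power_profile p r * cpow (1 + h N / (1 + r)) (- p).
      have hN1 : 0 < 1 + h N by rewrite addr_gt0.
      have u0 : 0 < 1 + (1 + h N)^-1 * r.
        by rewrite ltr_pwDl// mulr_ge0// invr_ge0 ltW.
      have w0 : 0 < 1 + h N / (1 + r) by rewrite addr_gt0// divr_gt0// r1.
      rewrite /power_profile -(cpowM _ hN1 u0) -(cpowM _ (r1 _ r0) w0).
      have -> // : (1 + h N) * (1 + (1 + h N)^-1 * r) = (1 + r) * (1 + h N / (1 + r)).
      have a0 : 1 + h N != 0 by rewrite gt_eqF.
      have b0 : 1 + r != 0 by rewrite gt_eqF ?r1.
      by rewrite !mulrDr !mulr1 mulVKf// [(1 + r) * _]mulrC divfK// addrAC.
    rewrite /gN mulrAC mulNr dil; ring.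
  have hi : (h N / (1 + r))%:C = (h N)%:C * ((1 + r)^-1)%:C.
    by apply: complex_eq; rewrite /= !(mulr0, mul0r, subr0, addr0).
  congr (_ * _); rewrite /E hi; move: (cpow _ _) => c.
  have := hC N; move: ((h N)%:C) ((1 + r)^-1%:C) => H i H0.
  by field; rewrite H0.
have hr N r : 0 <= r -> h N / (1 + r) <= h N.
  by move=> r0; rewrite ler_pdivrMr ?r1// ler_peMr ?(ltW (h0 N))// lerDl.
(* The remainder is taken at [h N / (1 + r) <= h N], so dividing it by [h N] leaves a bound free of
   [r]. *)
have Eb N r (e : R) : 0 <= r -> 0 <= e -> Normc.normc (E N r) <= e * (h N / (1 + r)) ->
    Normc.normc (E N r / (p * (h N)%:C)) <= e / Normc.normc p.
  move=> r0 e0 Ee; rewrite Normc.normcM Normc.normcV Normc.normcM normc_real gtr0_norm//.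
  rewrite ler_pdivrMr ?mulr_gt0//; apply: le_trans Ee _.
  by rewrite [leRHS]mulrA mulfVK ?gt_eqF// ler_wpM2l// hr.
have pW r : 0 <= r -> Normc.normc (power_profile p r) <= W r.
  by move=> r0; rewrite normc_power_profile// W_decr.
apply: (Klim (gN := gN) (C := 1 + 1 / Normc.normc p)).
- exact: cmeasurable_cpow1D.
- move=> N; apply: Klin => //; apply: Kdil => //.
  by rewrite invr_gt0 addr_gt0.
- move=> N r r0; rewrite gNE// Normc.normcM mulrC.
  apply: ler_pM; rewrite ?normc_ge0// ?pW//.
  apply: le_trans (normc_triangle _ _) _; rewrite normc_opp lerD//.
    rewrite normc_real gtr0_norm ?invr_gt0 ?r1// invf_le1 ?r1//.
    by rewrite lerDl.
  apply: Eb => //; apply: dE; rewrite divr_gt0 ?r1//=.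
  by apply: le_lt_trans (hr _ _ r0) _; rewrite ltr_pdivrMr// ltr_pMr// ltr1n.
move=> r r0; apply/cvgrPdist_le => e e0.
have [d' d'0 d'E] := cpow_first_order (- p) (mulr_gt0 e0 np0).
near=> N; rewrite sub0r normrN ger0_norm ?normc_ge0//.
rewrite gNE// power_profileS// -mulrBr addrAC subrr add0r Normc.normcM normc_opp.
have -> : e = 1 * (e * Normc.normc p / Normc.normc p) by rewrite mul1r mulfK ?gt_eqF.
apply: ler_pM; rewrite ?normc_ge0//.
  apply: le_trans (pW _ r0) _.
  by have := W_decr (lexx _) (lexx 0) r0; rewrite {1}/W addr0 powR1.
apply: Eb => //; first by rewrite mulr_ge0 ?ltW.
apply: d'E; rewrite divr_gt0 ?r1//=; apply: le_lt_trans (hr _ _ r0) _.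
rewrite /h; near: N.
have dd : 0 < d' / d by rewrite divr_gt0.
have := near_infty_natSinv_lt (PosNum dd); apply: filterS => N /= Nd.
rewrite mulrC -ltr_pdivlMr//; apply: le_lt_trans Nd.
by rewrite lef_pV2 ?posrE// ler_nat.
Unshelve. all: by end_near. Qed.

(** Factoring out [(1 + r)^-s] turns domination by the weight into plain boundedness, the setting of
    polynomial approximation. *)
Let K' (phi : R -> R[i]) := K (fun r => power_profile s r * phi r).

Let mpow : cmeasurable_fun (power_profile s).
Proof. exact: cmeasurable_cpow1D. Qed.

Let W1 r : 0 <= r -> Normc.normc (power_profile s r) = W r.
Proof. by move=> r0; rewrite normc_power_profile. Qed.

Let K'lin : linear_class K'.
Proof.
move=> c1 c2 g1 g2 K1 K2; rewrite /K'.
rewrite (_ : (fun r => _) = (fun r => c1 * (power_profile s r * g1 r) +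
  c2 * (power_profile s r * g2 r))); first exact: Klin.
by apply/funext => r; ring.
Qed.

Let K'lim : limit_closed (fun=> 1) K'.
Proof.
move=> gN g C mg KN gC gNg.
apply: (Klim (gN := fun N r => power_profile s r * gN N r) (C := C)) => //.
- exact: cmeasurableM.
- move=> N r r0; rewrite Normc.normcM W1// mulrC.
  rewrite ler_wpM2r ?powR_ge0//; have := gC N _ r0; by rewrite mulr1.
- move=> r r0; rewrite (_ : (fun N => _) =
    (fun N => W r * Normc.normc (gN N r - g r))); last first.
    by apply/funext => N; rewrite -mulrBr Normc.normcM W1.
  rewrite -(mulr0 (W r)); exact: cvgMr (gNg _ r0).
Qed.

(** The variable of the polynomials, [1 / (1 + r)] for [r >= 0]; as a real power it is measurable on
    the whole line. *)
Let X (r : R) : R := (1 + r) `^ (-1).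

Let XE r : 0 <= r -> X r = (1 + r)^-1.
Proof. by move=> r0; rewrite /X powR_inv1// addr_ge0. Qed.

Let X01 r : 0 <= r -> 0 <= X r <= 1.
Proof.
move=> r0; have r1 : 0 < 1 + r by rewrite ltr_pwDl.
by rewrite XE// invr_ge0 (ltW r1)/= invf_le1// lerDl.
Qed.

Let mX : measurable_fun setT X.
Proof.
apply: (measurableT_comp (measurable_powR (-1 : R))).
exact: measurable_funD.
Qed.

Let K'_power k : K (power_profile s) -> K' (fun r => (X r ^+ k)%:C).
Proof.
move=> Ks.
have Re_nat j : complex.Re (s + j%:R) = complex.Re s + j%:R.
  have -> : j%:R = (j%:R : R)%:C :> R[i] by rewrite rmorph_nat.
  by case: (s).
have Kk : K (power_profile (s + k%:R)).
  elim: (k) => [|j IH]; first by rewrite addr0.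
  rewrite -natr1 addrA; apply: power_profile_raise => //.
  by rewrite Re_nat lerDl.
apply: (limit_closed_ext (C := 1) Klim _ _ _ Kk).
- apply: cmeasurableM => //; split => //=; exact: measurable_funX.
- move=> r r0; rewrite normc_power_profile// mul1r.
  by apply: W_decr => //; rewrite Re_nat lerDl.
- move=> r r0; rewrite XE//; elim: (k) => [|j IH].
    by rewrite addr0 expr0 mulr1.
  by rewrite -natr1 addrA power_profileS// IH exprSr rmorphM mulrA.
Qed.

Let K'_poly (P : {poly R}) : K (power_profile s) -> K' (fun r => (P.[X r])%:C).
Proof.
move=> Ks; rewrite (_ : (fun r => _) =
    (fun r => \sum_(k < size P) (P`_k)%:C * (X r ^+ k)%:C)); last first.
  apply/funext => r; rewrite horner_coef rmorph_sum; apply: eq_bigr => k _.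
  by rewrite rmorphM.
apply: (linear_class_sum _ (fun k => (P`_k)%:C) (g := fun k r => (X r ^+ k)%:C)) => //.
by move=> k; exact: K'_power.
Qed.

(** The polynomials [P n] take values in [[0, 1]] at [1 / (1 + r)], so their pointwise convergence
    to the indicator of [r < t] is dominated by 1. *)
Let K'_step t : 0 < t -> K (power_profile s) -> K' (step t).
Proof.
move=> t0 Ks.
pose P n : {poly R} := 1 - (1 - 'X^n) ^+ threshold_exponent t n.
have PE n r : (P n).[X r] = 1 - (1 - X r ^+ n) ^+ threshold_exponent t n.
  by rewrite /P !(hornerE, horner_exp, hornerXn).
apply: (K'lim (gN := fun N r => ((P N.+1).[X r])%:C) (C := 1)).
- exact: cmeasurable_step.
- by move=> N; exact: K'_poly.
- move=> N r r0; have /andP[x0 x1] := X01 r0.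
  have y0 : 0 <= 1 - X r ^+ N.+1 by rewrite subr_ge0 exprn_ile1.
  have y1 : 1 - X r ^+ N.+1 <= 1 by rewrite gerBl exprn_ge0.
  rewrite normc_real PE mulr1 ger0_norm; last by rewrite subr_ge0 exprn_ile1.
  by rewrite gerBl exprn_ge0.
move=> r r0; have [D DP] := threshold_limit t0 r0.
apply/cvgrPdist_le => e e0; near=> N.
rewrite sub0r normrN ger0_norm ?normc_ge0//.
have -> : step t r = (if r < t then 1 else 0 : R)%:C by rewrite /step; case: ifP.
rewrite -rmorphB normc_real PE XE//; apply: le_trans (DP N.+1 isT) _.
have D0 : 0 <= D.
  by have := DP 1%N isT; rewrite divr1; apply: le_trans.
rewrite ler_pdivrMr// mulrC; near: N.
exists (Num.truncn (D / e)).+1 => // N /= DN.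
rewrite -ler_pdivrMr//; apply: ltW; apply: lt_le_trans (truncnS_gt _) _.
by rewrite ler_nat; exact: leqW.
Unshelve. all: by end_near. Qed.

(** Writing [1 + r' = (1 + r) (1 + v)] moves the question to the base point 1, where the first-order
    expansion bounds the increment by [A * v]. *)
Let cpow_right (z : R[i]) (r e : R) : 0 <= r -> 0 < e ->
  exists2 d : R, 0 < d & forall r', r < r' < r + d ->
  Normc.normc (cpow (1 + r') z - cpow (1 + r) z) < e.
Proof.
move=> r0 e0; have r1 : 0 < 1 + r by rewrite ltr_pwDl.
have [d d0 dE] := cpow_first_order z (ltr01 : 0 < 1 :> R).
pose B := Normc.normc (cpow (1 + r) z).
have B0 : 0 <= B by exact: normc_ge0.
pose A := Normc.normc z + 1.
have A0 : 0 < A by rewrite ltr_wpDl ?normc_ge0.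
have BA : 0 < (B + 1) * A by rewrite mulr_gt0// ltr_wpDl.
exists (Num.min d (e / ((B + 1) * A))); first by rewrite lt_min d0 divr_gt0.
move=> r' /andP[rr']; rewrite -ltrBlDl lt_min => /andP[vd ve].
have w0 : 0 < r' - r by rewrite subr_gt0.
pose v := (r' - r) / (1 + r).
have v0 : 0 < v by rewrite divr_gt0.
have vw : v <= r' - r.
  by rewrite /v ler_pdivrMr// ler_peMr ?(ltW w0)// lerDl.
have -> : 1 + r' = (1 + r) * (1 + v) by rewrite /v; field; rewrite gt_eqF.
have v1 : 0 < 1 + v by rewrite addr_gt0.
rewrite (cpowM z r1 v1) -[X in _ - X]mulr1 -mulrBr Normc.normcM -/B.
have vA : Normc.normc (cpow (1 + v) z - 1) <= A * v.
  have -> : cpow (1 + v) z - 1 = (cpow (1 + v) z - 1 - z * v%:C) + z * v%:C.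
    by rewrite subrK.
  apply: le_trans (normc_triangle _ _) _; rewrite Normc.normcM normc_real.
  rewrite gtr0_norm// /A mulrDl addrC lerD// ?dE ?v0 ?(le_lt_trans vw)//.
apply: (@le_lt_trans _ _ (B * (A * (r' - r)))).
  by rewrite ler_wpM2l// (le_trans vA)// ler_wpM2l// ltW.
move: ve; rewrite ltr_pdivlMr//; apply: le_lt_trans.
by rewrite mulrA mulrC ler_wpM2l ?(ltW w0)// ler_wpM2r ?(ltW A0)// lerDl.
Qed.

Lemma power_profile_step : K (power_profile s) -> K (step 1).
Proof.
move=> Ks.
(* [G] cancels the factor [power_profile s] and leaves [step 1]. It is bounded, and still
   right-continuous at its jump. *)
pose G r : R[i] := cpow (1 + r) s * step 1 r.
have mG : cmeasurable_fun G.
  apply: cmeasurableM; [exact: cmeasurable_cpow1D|exact: cmeasurable_step].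
have GB r : 0 <= r -> Normc.normc (G r) <= 2 `^ complex.Re s.
  move=> r0; rewrite /G /step; case: ifPn => r1; last first.
    by rewrite mulr0 Normc.normc0 powR_ge0.
  rewrite mulr1 normc_cpow ?ltr_pwDl//.
  apply: ge0_ler_powR; rewrite ?nnegrE ?(ltW s0) ?addr_ge0//.
  by rewrite -(natr1 1) lerD2l ltW.
have KG : K' G.
  apply: (@step_approximation _ K' (fun=> 2 `^ complex.Re s)) => //.
  - move=> gN g C mg KN gC gNg.
    apply: (K'lim (gN := gN) (C := C * 2 `^ complex.Re s)) => // N r r0.
    by rewrite mulr1 gC.
  - by move=> t t0; exact: K'_step.
  - by move=> r r' r0 rr'; rewrite GB// (le_trans r0).
  - move=> r e r0 e0; have [r1|r1] := ltP r 1; last first.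
      exists 1 => // r' /andP[rr' _].
      rewrite /G /step !ifF; first by rewrite !mulr0 subrr Normc.normc0.
        by rewrite ltNge r1.
      by rewrite ltNge (le_trans r1)// ltW.
    have [d d0 dP] := cpow_right s r0 e0.
    (* Staying within [1 - r] keeps [r'] to the left of the jump. *)
    exists (Num.min d (1 - r)); first by rewrite lt_min d0 subr_gt0.
    move=> r' /andP[rr']; rewrite -ltrBlDl lt_min => /andP[vd].
    rewrite ltrD2r => r'1; rewrite /G /step r1 r'1 !mulr1; apply: dP.
    by rewrite rr' -ltrBlDl.
apply: (limit_closed_ext (C := 2 `^ complex.Re s) Klim _ _ _ KG).
- exact: cmeasurable_step.
- by move=> r r0; rewrite Normc.normcM W1// mulrC ler_wpM2r ?powR_ge0// GB.
- move=> r r0; rewrite /G mulrA /power_profile cpowN mulVf ?mul1r//.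
  exact: cpow_neq0.
Qed.

Lemma step_power_profile : K (step 1) -> K (power_profile s).
Proof.
move=> K1; apply: (@step_approximation _ K W) => //.
(* Dilations produce every threshold [t] from the threshold 1. *)
- move=> t t0; rewrite (_ : step t = (fun r => step 1 (t^-1 * r))).
    by apply: (Kdil _ K1); rewrite invr_gt0.
  by apply/funext => r; rewrite /step mulrC ltr_pdivrMr// mul1r.
- by move=> r r0; exact: powR_ge0.
- move=> r r' r0 rr'; rewrite normc_power_profile ?(le_trans r0)//.
  exact: W_decr.
- by move=> r e r0 e0; exact: cpow_right.
Qed.

End tauberian_class.

(** * Dilated means of powers and of balls *)

Section vanishing_classes.
Context {R : realType}.
Variable m : nat.
Notation mu := (rV_lebesgue R m).
Implicit Types (g : R -> R[i]) (h f : 'rV[R]_m -> R[i]).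

Lemma profile_linear (a : R) : linear_class (profile a).
Proof.
move=> c1 c2 g1 g2 [m1 [C1 b1]] [m2 [C2 b2]]; split.
  by apply: cmeasurableD; apply: cmeasurableM => //; exact: cmeasurable_cst.
exists (Normc.normc c1 * C1 + Normc.normc c2 * C2) => r r0.
apply: le_trans (normc_triangle _ _) _; rewrite mulrDl.
by rewrite (Normc.normcM c1) (Normc.normcM c2) -!mulrA lerD// ler_wpM2l ?normc_ge0 ?b1 ?b2.
Qed.

Lemma profile_dilation (a : R) g (c : R) : 0 <= a -> 0 < c ->
  profile a g -> profile a (fun r => g (c * r)).
Proof.
move=> a0 c0 [mg [C gC]]; split; first exact: (cmeasurableT_comp mg).
have C0 : 0 <= C.
  have := gC 0 (lexx 0); rewrite addr0 powR1 mulr1; apply: le_trans.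
  exact: normc_ge0.
(* This choice gives [1 + c * r >= k * (1 + r)], so the decay survives dilation up to the factor
   [k^-a]. *)
pose k := Num.min 1 c.
have k0 : 0 < k by rewrite lt_min ltr01.
exists (C * k `^ (- a)) => r r0; apply: le_trans (gC _ _) _.
  by rewrite mulr_ge0// ltW.
rewrite -mulrA ler_wpM2l// !powRN -invfM -powRM ?(ltW k0) ?addr_ge0//.
have cr1 : 0 < 1 + c * r by rewrite ltr_pwDl// mulr_ge0// ltW.
have kr : 0 < k * (1 + r) by rewrite mulr_gt0// ltr_pwDl.
rewrite lef_pV2 ?posrE ?powR_gt0//; apply: ge0_ler_powR; rewrite ?nnegrE ?(ltW kr) ?(ltW cr1)//.
by rewrite mulrDr mulr1 lerD ?ge_min ?lexx// ler_wpM2r// ge_min lexx orbT.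
Qed.

Lemma profile_power (s : R[i]) : profile (complex.Re s) (power_profile s).
Proof.
split; first exact: cmeasurable_cpow1D.
by exists 1 => r r0; rewrite normc_power_profile// mul1r.
Qed.

Lemma profile_step (a : R) : 0 <= a -> profile a (step 1).
Proof.
move=> a0; split; first exact: cmeasurable_step.
(* For [0 <= r < 1] the weight [(1 + r)^-a] is at least [2^-a]. *)
exists (2 `^ a) => r r0; rewrite /step; case: ifPn => r1; last first.
  by rewrite Normc.normc0 mulr_ge0 ?powR_ge0.
rewrite Normc.normc1 powRN ler_pdivlMr ?powR_gt0 ?ltr_pwDl// mul1r.
apply: ge0_ler_powR; rewrite ?nnegrE ?addr_ge0//.
by rewrite -(natr1 1) lerD2l ltW.
Qed.

Section bounded_function.
Variables (h : 'rV[R]_m -> R[i]) (x0 : 'rV[R]_m) (M : R) (s : R[i]).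
Hypothesis mh : cmeasurable_fun h.
Hypothesis hM : {ae mu, forall x, Normc.normc (h x) <= M}.
Hypothesis ms : m%:R < 2 * complex.Re s.
Hypothesis s0 : 0 < complex.Re s.

(** The profiles of order [Re s] with vanishing mean form a class to which both directions of the
    Tauberian argument apply. *)
Lemma vanishing_mean_power_step :
  vanishing_mean h x0 (power_profile s) <-> vanishing_mean h x0 (step 1).
Proof.
pose K g := profile (complex.Re s) g /\ vanishing_mean h x0 g.
have Klin : linear_class K.
  move=> c1 c2 g1 g2 [p1 v1] [p2 v2]; split; first exact: profile_linear.
  exact: (vanishing_meanD mh hM ms).
have Kdil g (c : R) : 0 < c -> K g -> K (fun r => g (c * r)).
  move=> c0 [pg vg]; split; first by apply: profile_dilation => //; exact: ltW.
  exact: vanishing_mean_dilation.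
have Klim : limit_closed (fun r => (1 + r) `^ (- complex.Re s)) K.
  move=> gN g C mg KN gNC gNg; split.
    by split=> //; exists C; exact: (profile_limit gNC gNg).
  apply: (vanishing_mean_limit mh hM ms mg _ gNC gNg).
    by move=> N; have [[]] := KN N.
  by move=> N; have [] := KN N.
split=> v.
  by have [] : K (step 1) by apply: (power_profile_step s0) => //; split=> //; exact: profile_power.
have [] // : K (power_profile s).
by apply: (step_power_profile s0) => //; split=> //; apply: profile_step; exact: ltW.
Qed.

End bounded_function.

(** An affine change of variables removes [x0], and its Jacobian cancels the prefactor, so the mean
    of a constant depends neither on [x0] nor on [y]. *)
Lemma dilated_mean_cst (c : R[i]) (x0 : 'rV[R]_m) g (a y : R) : m%:R < 2 * a -> profile a g ->
  0 < y ->
  dilated_mean (fun=> c) x0 g y = c * cintegral mu setT (fun x => g (enorm x ^+ 2)).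
Proof.
move=> ma pg y0; rewrite /dilated_mean.
have ig : cintegrable mu (fun x => g (enorm x ^+ 2)).
  have m1 : cmeasurable_fun (fun _ : 'rV[R]_m => 1 : R[i]) by exact: cmeasurable_cst.
  have le1 : {ae mu, forall x, Normc.normc (1 : R[i]) <= 1}.
    by apply: aeW => x; rewrite Normc.normc1.
  have := profile_cintegrable 0 m1 le1 ma pg ltr01; congr cintegrable.
  by apply/funext => x; rewrite subr0 expr1n divr1 mulr1.
have -> : (fun x => g (enorm (x - x0) ^+ 2 / y ^+ 2) * c) =
    (fun x => c * g (enorm (y^-1 *: x + - (y^-1 *: x0)) ^+ 2)).
  by apply/funext => x; rewrite -scalerBr enorm_sqrZ exprVn mulrC [in RHS](mulrC (_^-1)).
have y'0 : 0 < y^-1 by rewrite invr_gt0.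
rewrite cintegralZ; last first.
  by have [? ?] := ig; split; apply: (integrable_rV_affine _ y'0
    (h := fun x => _ (g (enorm x ^+ 2)))).
rewrite (cintegral_rV_affine _ y'0 ig) exprVn invrK mulrCA; congr (_ * _); rewrite mulrA -rmorphM/=.
by rewrite mulVf ?mul1r// expf_neq0// gt_eqF.
Qed.

Lemma cintegral_eball f (x0 : 'rV[R]_m) (r : R) : 0 < r ->
  cintegral mu (eball x0 r) f = (r ^+ m)%:C * dilated_mean f x0 (step 1) r.
Proof.
move=> r0; rewrite /dilated_mean mulrA -rmorphM/= mulfV ?expf_neq0 ?gt_eqF// mul1r.
rewrite cintegral_mkcond; congr (cintegral mu setT _); apply/funext => x.
congr (_ * _); rewrite /step ltr_pdivrMr ?exprn_gt0// mul1r eball_sqr//.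
have -> : (x \in [set z | enorm (z - x0) ^+ 2 < r ^+ 2]) =
    (enorm (x - x0) ^+ 2 < r ^+ 2) by apply/idP/idP; rewrite inE.
by case: ifP.
Qed.

Lemma cintegral_cst1 A : measurable A ->
  cintegral mu A (fun=> 1 : R[i]) = (fine (mu A))%:C.
Proof.
move=> mA; rewrite /cintegral /=; congr (_ +i* _).
  by rewrite Rintegral_cst// mul1r.
by rewrite Rintegral_cst// mul0r.
Qed.

Let V : R := fine (mu (eball 0 1)).

Lemma fine_eball_gt0 : 0 < V.
Proof.
rewrite fine_gt0// rV_lebesgue_eball_gt0//=.
by apply: le_lt_trans (rV_lebesgue_eball_le m ltr01) _; rewrite ltry.
Qed.

Lemma cintegral_step :
  cintegral mu setT (fun x => step 1 (enorm x ^+ 2)) = V%:C.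
Proof.
rewrite -cintegral_cst1; last exact: measurable_eball.
rewrite cintegral_eball// expr1n mul1r /dilated_mean !expr1n invr1 mul1r.
by congr (cintegral mu setT _); apply/funext => x; rewrite subr0 !mulr1.
Qed.

Lemma fine_eball (x0 : 'rV[R]_m) (r : R) : 0 < r -> fine (mu (eball x0 r)) = r ^+ m * V.
Proof.
move=> r0; have := cintegral_cst1 (measurable_eball x0 r0).
(* Any order above [m / 2] will do, since [step 1] is a profile of every nonnegative order. *)
have a0 : m%:R < 2 * m.+1%:R :> R.
  by rewrite -natrM ltr_nat mul2n -addnn ltn_addr.
rewrite cintegral_eball// (dilated_mean_cst 1 x0 a0)//; last exact: profile_step.
by rewrite mul1r cintegral_step -rmorphM/= => -[->].
Qed.

(** Otherwise the power means of the constant 1 would vanish, and by the Tauberian equivalence its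
    means for [step 1] would tend to 0, whereas they all equal [V > 0]. *)
Lemma cintegral_power_neq0 (s : R[i]) : m%:R < 2 * complex.Re s ->
  0 < complex.Re s ->
  cintegral mu setT (fun x => power_profile s (enorm x ^+ 2)) != 0.
Proof.
move=> ms s0; apply/eqP => I0.
have h1 : {ae mu, forall x, Normc.normc (1 : R[i]) <= 1}.
  by apply: aeW => x; rewrite Normc.normc1.
have := vanishing_mean_power_step 0 (cmeasurable_cst _ 1) h1 ms s0 => -[H _].
have [|Y [_ HY]] := H _ _ fine_eball_gt0.
  move=> e e0; near=> y.
  rewrite (dilated_mean_cst _ _ ms (profile_power s)).
    by rewrite I0 mulr0 Normc.normc0.
  near: y; exact: nbhs_pinfty_gt.
pose y := Num.max Y 0 + 1.
have y0 : 0 < y by rewrite ltr_wpDl// le_max lexx orbT.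
have := HY y; rewrite (dilated_mean_cst _ _ ms (profile_step (ltW s0)) y0).
rewrite cintegral_step mul1r normc_real gtr0_norm ?fine_eball_gt0// ltxx.
have Yy : Y < y by rewrite (@le_lt_trans _ _ (Num.max Y 0)) ?le_max ?lexx// ltrDl.
by move=> /(_ Yy).
Unshelve. all: by end_near. Qed.

Lemma ball_averageE f (x0 : 'rV[R]_m) (r : R) : 0 < r ->
  ball_average f x0 r = V^-1%:C * dilated_mean f x0 (step 1) r.
Proof.
move=> r0; rewrite /ball_average fine_eball// cintegral_eball// mulrA.
congr (_ * _); rewrite -rmorphM/= invfM mulrAC mulVf ?mul1r//.
by rewrite expf_neq0// gt_eqF.
Qed.

(** Splitting off the constant [L] reduces convergence to [L] to convergence to 0, where the
    Tauberian equivalence applies. *)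
Lemma dilated_mean_shift f (x0 : 'rV[R]_m) (L : R[i]) g (a M y : R) : cmeasurable_fun f ->
  {ae mu, forall x, Normc.normc (f x) <= M} -> m%:R < 2 * a -> profile a g ->
  0 < y -> dilated_mean f x0 g y = dilated_mean (fun x => f x - L) x0 g y +
    L * cintegral mu setT (fun x => g (enorm x ^+ 2)).
Proof.
move=> mf fM ma pg y0; rewrite -(dilated_mean_cst L x0 ma pg y0) /dilated_mean -mulrDr.
have L1 : {ae mu, forall x, Normc.normc (- L) <= Normc.normc L}.
  by apply: aeW => x; rewrite normc_opp.
have i1 := profile_cintegrable x0 mf fM ma pg y0.
have i2 := profile_cintegrable x0 (cmeasurable_cst _ (- L)) L1 ma pg y0.
have L2 : {ae mu, forall x, Normc.normc L <= Normc.normc L} by apply: aeW.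
have i3 := profile_cintegrable x0 (cmeasurable_cst _ L) L2 ma pg y0.
rewrite -cintegralD//; last first.
  have := cintegrableD i1 i2; congr cintegrable.
  by apply/funext => x; rewrite mulrDr.
by congr (_ * cintegral mu setT _); apply/funext => x; rewrite -mulrDr subrK.
Qed.

End vanishing_classes.

(** * The Poisson transform *)

Section poisson.
Context {R : realType}.
Variables (n : nat) (lam : R[i]).
Hypothesis n2 : (2 <= n)%N.
Hypothesis lam0 : 0 < complex.Im lam.
Notation m := n.-1.
Notation mu := (rV_lebesgue R m).

Definition poisson_exponent : R[i] := (rho n)%:C - 'i%C * lam.
Let s := poisson_exponent.

Lemma rhoE : 2 * rho n = m%:R :> R.
Proof.
rewrite /rho mulrC divfK ?pnatr_eq0//; case: n n2 => // k _.
by rewrite -natr1 addrK.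
Qed.

Lemma Re_poisson_exponent : complex.Re s = rho n + complex.Im lam.
Proof.
rewrite /s /poisson_exponent; case: lam => a b /=.
by rewrite !mul0r sub0r mul1r opprK.
Qed.

Lemma poisson_exponent_gt0 : 0 < complex.Re s.
Proof.
have := rhoE; rewrite Re_poisson_exponent => r.
have : 0 <= rho n :> R by rewrite -(@pmulr_rge0 _ 2)// r.
by move=> /ltr_wpDl; exact.
Qed.

Lemma lt_poisson_exponent : m%:R < 2 * complex.Re s.
Proof. by rewrite Re_poisson_exponent mulrDr rhoE ltrDl mulr_gt0. Qed.

Lemma enormN (x : 'rV[R]_m) : enorm (- x) = enorm x.
Proof. by rewrite /enorm; congr Num.sqrt; apply: eq_bigr => i _; rewrite mxE sqrrN. Qed.

(** Factor [y^2] out of the denominator; as the norm is even, the convolution kernel at height [y]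
    is a dilated power profile. *)
Lemma unnormalized_poissonE (x x0 : 'rV[R]_m) (y : R) : 0 < y ->
  unnormalized_poisson lam (x0 - x, y) =
  cpow y (- s) * power_profile s (enorm (x - x0) ^+ 2 / y ^+ 2).
Proof.
move=> y0; rewrite /unnormalized_poisson /= -/poisson_exponent -/s.
rewrite -[x0 - x]opprB enormN; set q := enorm _ ^+ 2.
have q0 : 0 <= q by rewrite sqr_ge0.
have w0 : 0 < 1 + q / y ^+ 2 by rewrite ltr_pwDl// mulr_ge0// invr_ge0 sqr_ge0.
have -> : y / (y ^+ 2 + q) = y^-1 * (1 + q / y ^+ 2)^-1.
  have y1 : y != 0 by rewrite gt_eqF.
  have y2 : y ^+ 2 + q != 0 by rewrite gt_eqF// ltr_pwDl// exprn_gt0.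
  by field; rewrite y1 y2.
by rewrite cpowM ?invr_gt0// !cpowV.
Qed.

Let I : R[i] := cintegral mu setT (fun x => power_profile s (enorm x ^+ 2)).

Let cI : cintegrable mu (fun x => power_profile s (enorm x ^+ 2)).
Proof.
have m1 : cmeasurable_fun (fun _ : 'rV[R]_m => 1 : R[i]) by exact: cmeasurable_cst.
have le1 : {ae mu, forall x, Normc.normc (1 : R[i]) <= 1}.
  by apply: aeW => x; rewrite Normc.normc1.
have := profile_cintegrable 0 m1 le1 lt_poisson_exponent (profile_power _) ltr01.
congr cintegrable; apply/funext => x.
by rewrite subr0 expr1n divr1 mulr1.
Qed.

Lemma poisson_constE : poisson_const n lam * I = 1.
Proof.
have E d : cintegral mu setT (fun x => d * unnormalized_poisson lam (x, 1)) = d * I.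
  rewrite -cintegralZ//; congr (cintegral mu setT _); apply/funext => x.
  congr (_ * _); have := unnormalized_poissonE 0 x ltr01.
  by rewrite subr0 sub0r enormN expr1n divr1 /cpow ln1 mulr0 cexp0 mul1r.
have I0 : I != 0.
  exact: cintegral_power_neq0 lt_poisson_exponent poisson_exponent_gt0.
(* [xget] falls back on 0 only if no constant qualifies, and [I^-1] does. *)
rewrite -E /poisson_const; case: xgetP => [d _ //|/(_ I^-1)].
by rewrite /= E mulVf.
Qed.

Lemma poisson_transformE (f : 'rV[R]_m -> R[i]) (x0 : 'rV[R]_m) (M y : R) :
  cmeasurable_fun f -> {ae mu, forall x, Normc.normc (f x) <= M} -> 0 < y ->
  cpow y (- ((rho n)%:C + 'i%C * lam)) * poisson_transform lam f (x0, y) =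
  poisson_const n lam * dilated_mean f x0 (power_profile s) y.
Proof.
move=> mf fM y0; rewrite /poisson_transform /=.
have -> : (fun xi => poisson_kernel lam (x0 - xi, y) * f xi) =
    (fun x => (poisson_const n lam * cpow y (- s)) *
      (power_profile s (enorm (x - x0) ^+ 2 / y ^+ 2) * f x)).
  by apply/funext => x; rewrite /poisson_kernel unnormalized_poissonE// !mulrA.
rewrite cintegralZ; last first.
  exact: (profile_cintegrable x0 mf fM lt_poisson_exponent (profile_power _) y0).
rewrite /dilated_mean !mulrA; congr (_ * _).
rewrite (mulrC (cpow y _)) -mulrA; congr (_ * _).
(* [-(rho + i lam) - (rho - i lam) = - 2 rho = - m], so the powers of [y] combine to the prefactor
   of [dilated_mean]. *)
rewrite -cpowD (_ : _ - s = - m%:R); last first.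
  rewrite /s /poisson_exponent (_ : m%:R = (rho n)%:C + (rho n)%:C); first by ring.
  by rewrite -rmorphD/= -mulr2n -[rho n *+ 2]mulr_natl rhoE rmorph_nat.
by rewrite cpowN cpow_nat// fmorphV.
Qed.

End poisson.

(** * Reduction of both limits to vanishing means *)

Lemma cvg_affineP {R : realType} (F G : R -> R[i]) (c L : R[i]) : c != 0 ->
  (forall y, 0 < y -> F y = c * G y + L) ->
  (F y : R[i]^o) @[y --> +oo] --> (L : R[i]^o) <->
  (forall e : R, 0 < e -> \forall y \near +oo, Normc.normc (G y) < e).
Proof.
move=> c0 FG; have nc : 0 < Normc.normc c.
  by rewrite lt_neqAle normc_ge0 eq_sym andbT; apply: contra c0 => /eqP/Normc.eq0_normc ->.
rewrite (ccvgP _ F L); split=> H e e0.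
  have ce := mulr_gt0 nc e0; near=> y.
  have y0 : 0 < y by near: y; exact: nbhs_pinfty_gt.
  have : Normc.normc (F y - L) < Normc.normc c * e by near: y; exact: H.
  by rewrite FG// addrK Normc.normcM ltr_pM2l.
have ce : 0 < e / Normc.normc c by rewrite divr_gt0.
near=> y.
have y0 : 0 < y by near: y; exact: nbhs_pinfty_gt.
rewrite FG// addrK Normc.normcM mulrC -ltr_pdivlMr//.
by near: y; exact: H.
Unshelve. all: by end_near. Qed.

Lemma Linfty_ae_bounded {R : realType} m (f : 'rV[R]_m -> R[i]) : Linfty f ->
  exists M, {ae rV_lebesgue R m, forall x, Normc.normc (f x) <= M}.
Proof.
(* At exponent [+oo], [Lnorm] is the essential supremum only for a measure of positive mass; the
   unit ball provides this mass. *)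
move=> [mf]; rewrite /Linfty_norm unlock ifT; last first.
  apply: lt_le_trans (rV_lebesgue_eball_gt0 m (ltr01 : 0 < 1 :> R)) _.
  by apply: le_measure; rewrite ?inE//; exact: measurable_eball.
set e := ess_sup _ _ => eoo; exists (fine e).
have := ess_sup_ge (rV_lebesgue R m) (abse \o (fun x => (Normc.normc (f x))%:E)).
apply: filterS => x /=; rewrite -/e ger0_norm ?normc_ge0// => xe.
(* The value [-oo] is excluded by the bound at the point [x] itself, so [fine] loses nothing. *)
have efin : e \is a fin_num.
  by rewrite fin_numElt eoo andbT (lt_le_trans _ xe)// ltNyr.
by rewrite -lee_fin fineK.
Qed.

Theorem theorem3p4 (R : realType) (n : nat) (hn : (2 <= n)%N)
  (lam : R[i]) (hlam : 0 < complex.Im lam)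
  (u : 'rV[R]_n.-1 * R -> R[i])
  (hu : hyp_eigenfunction u (- (lam ^+ 2 + (rho n)%:C ^+ 2)))
  (hbound : (growth_norm lam u < +oo)%E)
  (f : 'rV[R]_n.-1 -> R[i]) (hf : boundary_function lam u f)
  (x0 : 'rV[R]_n.-1) (L : R[i]) :
  (cpow y (- ((rho n)%:C + 'i%C * lam)) * u (x0, y) : R[i]^o) @[y --> +oo]
    --> (L : R[i]^o)
  <->
  (ball_average f x0 r : R[i]^o) @[r --> +oo] --> (L : R[i]^o).
Proof.
have [fL uf] := hf; have [mf _] := fL; have [M fM] := Linfty_ae_bounded fL.
set s := poisson_exponent n lam.
have ms : n.-1%:R < 2 * complex.Re s := lt_poisson_exponent hn hlam.
have s0 : 0 < complex.Re s := poisson_exponent_gt0 hn hlam.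
pose h x := f x - L.
have mh : cmeasurable_fun h by apply: cmeasurableD => //; exact: cmeasurable_cst.
have hM : {ae rV_lebesgue R n.-1, forall x, Normc.normc (h x) <= M + Normc.normc L}.
  apply: filterS fM => x fx; apply: le_trans (normc_triangle _ _) _.
  by rewrite normc_opp lerD2r.
have dI := poisson_constE hn hlam.
have d0 : poisson_const n lam != 0.
  by apply/eqP => d0; move/eqP: dI; rewrite d0 mul0r eq_sym oner_eq0.
have V0 := fine_eball_gt0 (R := R) n.-1.
(* By the normalisation [dI], the constant split off from [f] contributes exactly [L]; on the ball
   side, division by the volume of the unit ball does the same. *)
rewrite (cvg_affineP d0 (G := dilated_mean h x0 (power_profile s))); last first.
  move=> y y0; rewrite uf// (poisson_transformE hn hlam x0 mf fM y0).
  rewrite (dilated_mean_shift x0 L mf fM ms (profile_power s) y0).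
  by rewrite mulrDr [X in _ + X]mulrCA dI mulr1.
have Vn0 : (fine (rV_lebesgue R n.-1 (eball 0 1)))^-1%:C != 0 :> R[i].
  by rewrite eq_complex /= eqxx andbT invr_eq0 gt_eqF.
rewrite (cvg_affineP Vn0 (G := dilated_mean h x0 (step 1))); last first.
  move=> r r0; rewrite ball_averageE//.
  rewrite (dilated_mean_shift x0 L mf fM ms (profile_step (ltW s0)) r0).
  rewrite mulrDr [X in _ + X]mulrCA cintegral_step -rmorphM/= mulVf ?gt_eqF//.
  by rewrite mulr1.
exact: (vanishing_mean_power_step x0 mh hM ms s0).
Qed.
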